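(* Suppose the sesquilinear form $B$ is coercive, i.e. $C_1\|u\|_{\mathcal{H}(\Omega)}^2\le|B(u,u)|$ for all $u\in\mathcal{H}(\Omega)$ with some $C_1>0$, and bounded, $|B(u,v)|\le C_b\|u\|_{\mathcal{H}(\Omega)}\|v\|_{\mathcal{H}(\Omega)}$. Let $u^e\in\mathcal{H}(\Omega)$ be the solution of $B(u^e,v)=F(v)$ for all $v\in\mathcal{H}(\Omega)$, where $F\in\mathcal{H}(\Omega)'$, and let $u^G$ be the abstract GFEM approximation, i.e. $u^G\in u^p+S_n(\Omega)$ with $B(u^G,v)=F(v)$ for all $v\in S_n(\Omega)$ (notation in context). Then (1) in the elliptic case (see context), $$\|u^e-u^G\|_{\mathcal{H}(\Omega)}\le\sqrt{\zeta\zeta^\ast}\;d_{\mathtt{max}}\;\|u^e\|_{\mathcal{H}(\Omega)};$$ (2) in general coercive cases, $$\|u^e-u^G\|_{\mathcal{H}(\Omega)}\le\frac{C_b}{C_1}\,d_{\mathtt{max}}\Big(\zeta\sum_{i=1}^M\big\|u^e|_{\omega_i^\ast}-\psi_i\big\|_{B^+,\omega_i^\ast}^2\Big)^{1/2}.$$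
   Context: **Abstract setting.** $\Omega\subset\mathbb{R}^d$ ($d=2,3$) is a bounded Lipschitz domain; $\mathcal{H}(\Omega)\subset\mathcal{L}(\Omega)\subset\mathcal{H}(\Omega)'$ are Hilbert spaces with continuous embeddings (dual with respect to the pivot space $\mathcal{L}(\Omega)$); $B$ is a sesquilinear form on $\mathcal{H}(\Omega)$. For every subdomain $D\subset\Omega$ there are Hilbert spaces $\mathcal{H}_0(D)\subset\mathcal{H}(D)$ (continuous embedding; $\mathcal{H}_0(\Omega)=\mathcal{H}(\Omega)$) with: (a) for $D\subset D^{\ast}$ a linear ''zero extension'' $E_{D,D^\ast}:\mathcal{H}_0(D)\to\mathcal{H}_0(D^{\ast})$ with $\|E_{D,D^\ast}u\|_{\mathcal{H}_0(D^\ast)}=\|u\|_{\mathcal{H}_0(D)}$, in particular $\|u\|_{\mathcal{H}_0(D)}=\|E_{D,\Omega}u\|_{\mathcal{H}(\Omega)}$; (b) for $D\subset D^\ast$ a linear ''restriction'' $R_{D^\ast,D}:\mathcal{H}(D^\ast)\to\mathcal{H}(D)$, $u\mapsto u|_D$, with $\|u|_D\|_{\mathcal{H}(D)}\le\|u\|_{\mathcal{H}(D^\ast)}$, $R_{D^\ast,D}\circ E_{D,D^\ast}=\mathrm{id}$, and $R_{D^\ast,D}\circ R_{D^{\ast\ast},D^\ast}=R_{D^{\ast\ast},D}$; (c) bounded sesquilinear forms $B_D$ on $\mathcal{H}(D)$ with $B_\Omega=B$ and $B_D(u|_D,v)=B_{D^\ast}(u,E_{D,D^\ast}v)$ for $D\subset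 D^\ast$, $u\in\mathcal{H}(D^\ast)$, $v\in\mathcal{H}_0(D)$. Elements of $\mathcal{H}_0(D)$ are identified with their zero extensions in $\mathcal{H}(\Omega)$. $\mathcal{L}(D)$ ($D\subset\Omega$) are associated local Hilbert spaces with $\mathcal{H}(D)\subset\mathcal{L}(D)$ and norm-nonincreasing restrictions. $\mathcal{H}_B(D)=\{u\in\mathcal{H}(D):B_D(u,v)=0\ \forall v\in\mathcal{H}_0(D)\}$. **Cover and partition of unity.** $\{\omega_i\}_{i=1}^M$ are overlapping subdomains with $\bigcup\omega_i=\Omega$, $\omega_i\subset\omega_i^\ast\subset\Omega$ are oversampling domains, and $P_i:\mathcal{H}(\omega_i)\to\mathcal{H}_0(\omega_i)$ are bounded linear operators with $u=\sum_iP_i(u|_{\omega_i})$ for all $u\in\mathcal{H}(\Omega)$. **Local particular functions.** $\psi_i\in\mathcal{H}(\omega_i^\ast)$ satisfies $B_{\omega_i^\ast}(\psi_i,v)=F(v)$ for all $v\in\mathcal{H}_0(\omega_i^\ast)$ (existence assumed); $u_i^p=\psi_i|_{\omega_i}$. **Semi-inner products.** $B^+_{\omega_i^\ast}$ is a semi-inner product on $\mathcal{H}(\omega_i^\ast)$ and $\mathcal{K}_i\subset\mathcal{H}_B(\omega_i^\ast)$ a finite-dimensional space, $l_i=\dim\mathcal{K}_i$, with $B^+_{\omega_i^\ast}(v,w)=0\ \forall w\in\mathcal{H}(\omega_i^\ast)$ iff $v\in\mathcal{K}_i$; $(\mathcal{H}_B(\omega_i^\ast)/\mathcal{K}_i,B^+_{\omega_i^\ast})$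 is a Hilbert space; $\|u\|_{B^+,\omega_i^\ast}=B^+_{\omega_i^\ast}(u,u)^{1/2}$. The operator $\widehat P_i:\mathcal{H}_B(\omega_i^\ast)\to\mathcal{H}_0(\omega_i)$, $\widehat P_iu=P_i(u|_{\omega_i})$, is injective on $\mathcal{K}_i$ and is compact. $\mathcal{H}^0_B(\omega_i^\ast)=\{v\in\mathcal{H}_B(\omega_i^\ast):(\widehat P_iv,\widehat P_iw)_{\mathcal{H}_0(\omega_i)}=0\ \forall w\in\mathcal{K}_i\}$. **Local approximation spaces.** $(\lambda_{i,j},\phi_{i,j})$ is the $j$-th eigenpair (non-ascending order, $\lambda\in\mathbb{R}\cup\{+\infty\}$) of $(\widehat P_i\phi,\widehat P_iv)_{\mathcal{H}_0(\omega_i)}=\lambda B^+_{\omega_i^\ast}(\phi,v)$ for all $v\in\mathcal{H}_B(\omega_i^\ast)$; the eigenvalue $+\infty$ has eigenspace $\mathcal{K}_i$, so $\phi_{i,1},\dots,\phi_{i,l_i}$ span $\mathcal{K}_i$ and the later eigenpairs are those of the same problem on $\mathcal{H}_B^0(\omega_i^\ast)$. For $n_i>l_i$, $S_{n_i}(\omega_i)=\mathrm{span}\{\phi_{i,1}|_{\omega_i},\dots,\phi_{i,n_i}|_{\omega_i}\}$. **Global objects.** $u^p=\sum_iP_iu_i^p$, $S_n(\Omega)=\{\sum_iP_i\phi_i:\phi_i\in S_{n_i}(\omega_i)\}$. **$n$-width.** $d_n(\omega_i,\omega_i^\ast)=\inf_{\dim Q=n,\,Q\subset\mathcal{H}_0(\omega_i)}\sup_{u\in\mathcal{H}_B^0(\omega_i^\ast)}\inf_{v\in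 Q}\|\widehat P_iu-v\|_{\mathcal{H}_0(\omega_i)}/\|u\|_{B^+,\omega_i^\ast}$, and $d_{\mathtt{max}}=\max_{1\le i\le M}d_{n_i-l_i}(\omega_i,\omega_i^\ast)$. **Constants.** $\zeta$ (coloring constant): an integer such that $\{\omega_i\}$ can be partitioned into $\zeta$ classes such that for any two distinct subdomains $\omega_{j_1},\omega_{j_2}$ in the same class, $(u_1,u_2)_{\mathcal{H}(\Omega)}=0$ for all $u_1\in\mathcal{H}_0(\omega_{j_1})$, $u_2\in\mathcal{H}_0(\omega_{j_2})$. $\zeta^\ast$: the smallest positive integer with $\sum_i\|u|_{\omega_i^\ast}\|^2_{\mathcal{L}(\omega_i^\ast)}\le\zeta^\ast\|u\|^2_{\mathcal{L}(\Omega)}$ for all $u\in\mathcal{L}(\Omega)$ and $\sum_i\|v|_{\omega_i^\ast}\|^2_{B^+,\omega_i^\ast}\le\zeta^\ast\|v\|^2_{\mathcal{H}(\Omega)}$ for all $v\in\mathcal{H}(\Omega)$. **Elliptic case.** $B$ is coercive and Hermitian, $\mathcal{H}(\Omega)$ carries the energy norm $\|u\|_{\mathcal{H}(\Omega)}=\sqrt{B(u,u)}$, and for all $i$, $B^+_{\omega_i^\ast}=B_{\omega_i^\ast}$ and $\psi_i\in\mathcal{H}_0(\omega_i^\ast)$.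
   Formalization: The formal theorem additionally assumes that each semi-inner product B^+ is bounded on H_B(ω_i^* ) with respect to the norm of H(ω_i^* ); without this, part (2) can fail (it is automatic in the elliptic case). It also assumes C_b ≥ 0. *)

(* Defs.v *)
From HB Require Import structures.
From mathcomp Require Import all_boot all_order all_algebra sesquilinear.
From mathcomp Require Import all_classical all_reals all_analysis.
From mathcomp Require Export complex.
Set Implicit Arguments.
Unset Strict Implicit.
Unset Printing Implicit Defensive.
Import Order.TTheory GRing.Theory Num.Def Num.Theory.
Import numFieldNormedType.Exports.
Local Open Scope classical_set_scope.
Local Open Scope ring_scope.
Local Open Scope complex_scope.

(* Norms over R[i] take their values in R[i] (as nonnegative real elements);
   [nrm] is the same number in R.  It applies to complex numbers too, where it
   is the modulus. *)
Definition nrm (R : realType) (V : normedZmodType R[i]) (x : V) : R :=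
  complex.Re `|x|.

Notation "`‖ x ‖" := (nrm x) (at level 0, x at level 99, format "`‖ x ‖")
  : ring_scope.

Definition bounded_op (R : realType) (U V : normedZmodType R[i]) (f : U -> V) :=
  exists c : R, forall x, `‖f x‖ <= c * `‖x‖.

Record hilbertType (R : realType) := Hilbert {
  hilbert_sort :> completeNormedModType R[i] ;
  hdot : {dot hilbert_sort for conjC} ;
  hdot_norm : forall x, hdot x x = `|x| ^+ 2 }.

Notation "⟪ u , v ⟫" := (hdot _ u v)
  (at level 0, u at level 99, v at level 99, format "⟪ u ,  v ⟫") : ring_scope.

(* Linear in the first argument, conjugate-linear in the second, as for the
   forms of sesquilinear.v. *)
Notation "{ 'sesquilinear' U }" :=
  ({bilinear U -> U -> _ | *%R & (conjC \; *%R)}) : type_scope.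

(* Functionals v |-> F v that can be equated with v |-> B u v. *)
Notation "{ 'antilinear' U }" := ({linear U -> _ | (conjC \; *%R)})
  : type_scope.

Definition bounded_form (R : realType) (V : normedModType R[i])
    (B : V -> V -> R[i]) (c : R) :=
  forall u v, `‖B u v‖ <= c * `‖u‖ * `‖v‖.

Definition coercive (R : realType) (V : normedModType R[i])
    (B : V -> V -> R[i]) (c : R) :=
  forall u, c * `‖u‖ ^+ 2 <= `‖B u u‖.

Definition hermitian_form (R : realType) (V : normedModType R[i])
    (B : V -> V -> R[i]) :=
  forall u v, B u v = conjC (B v u).

Section LinearSpan.
Variables (R : realType) (V : lmodType R[i]).

Definition lin_span (I : finType) (e : I -> V) : set V :=
  [set v | exists c : I -> R[i], v = \sum_i c i *: e i].

Definition lin_indep (I : finType) (e : I -> V) :=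
  forall c : I -> R[i], \sum_i c i *: e i = 0 -> forall i, c i = 0.

Definition has_dim (S : set V) (n : nat) :=
  exists e : 'I_n -> V, lin_indep e /\ S = lin_span e.

End LinearSpan.

Section Domains.
Variables (R : realType) (d : nat).
Implicit Types D : set 'rV[R]_d.

Definition is_domain D := [/\ D !=set0, open D & connected D].

Definition is_bounded D :=
  exists c : R, forall x, D x -> forall j, `|x 0 j| <= c.

(* Near each boundary point, after a rigid change of coordinates [Q] and the
   choice of a vertical coordinate [j], [D] is the strict epigraph of a
   Lipschitz function of the other coordinates. *)
Definition has_lipschitz_boundary D :=
  forall x, (closure D `\` D°) x ->
  exists (Q : 'M[R]_d) (j : 'I_d) (gamma : 'rV[R]_d.-1 -> R) (r : R),
    [/\ Q *m Q^T = 1%:M, lipschitz gamma, 0 < r &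
        forall y, ball x r y ->
          (D y <-> gamma (col' j (y *m Q)) < (y *m Q) 0 j)].

Record lipschitzDomain := LipschitzDomain {
  ldom_set :> set 'rV[R]_d ;
  ldom_domain : is_domain ldom_set ;
  ldom_bounded : is_bounded ldom_set ;
  ldom_lipschitz : has_lipschitz_boundary ldom_set }.

Record subdomain (Om : lipschitzDomain) := Subdomain {
  subdom_set :> set 'rV[R]_d ;
  subdom_domain : is_domain subdom_set ;
  subdom_sub : subdom_set `<=` Om }.

Definition whole (Om : lipschitzDomain) : subdomain Om :=
  Subdomain (ldom_domain Om) (@subset_refl _ (ldom_set Om)).

End Domains.

(* Inclusions of spaces are injective linear maps: [inc0] for H_0(D) in H(D),
   [incL] for H(D) in L(D).  Zero extensions and restrictions are given for all
   pairs of subdomains but constrained only for nested ones.  No compatibility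
   beyond the listed laws is assumed. *)

Record framework (R : realType) (d : nat) (Om : lipschitzDomain R d) :=
  Framework {
  Hs : subdomain Om -> hilbertType R ;
  H0s : subdomain Om -> hilbertType R ;
  Ls : subdomain Om -> hilbertType R ;

  inc0 : forall D, {linear H0s D -> Hs D} ;
  inc0_inj : forall D, injective (inc0 D) ;
  inc0_cont : forall D, continuous (inc0 D) ;
  (* H_0(Om) = H(Om) *)
  inc0_whole_surj : forall u, exists u0, inc0 (whole Om) u0 = u ;
  inc0_whole_norm : forall u0, `‖inc0 (whole Om) u0‖ = `‖u0‖ ;

  incL : forall D, {linear Hs D -> Ls D} ;
  incL_inj : forall D, injective (incL D) ;
  incL_cont : forall D, continuous (incL D) ;
  (* L(Om) embeds in H(Om)' by f |-> (v |-> (f, v)_L(Om)) *)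
  pivot_inj : forall f : Ls (whole Om),
    (forall v : Hs (whole Om), ⟪f, incL (whole Om) v⟫ = 0) -> f = 0 ;

  ext : forall D D' : subdomain Om, {linear H0s D -> H0s D'} ;
  ext_norm : forall D D' : subdomain Om, D `<=` D' ->
    forall u, `‖ext D D' u‖ = `‖u‖ ;

  res : forall D' D : subdomain Om, {linear Hs D' -> Hs D} ;
  res_norm : forall D' D : subdomain Om, D `<=` D' ->
    forall u, `‖res D' D u‖ <= `‖u‖ ;
  res_ext : forall D D' : subdomain Om, D `<=` D' ->
    forall u, res D' D (inc0 D' (ext D D' u)) = inc0 D u ;
  res_res : forall D D' D'' : subdomain Om, D `<=` D' -> D' `<=` D'' ->
    forall u, res D' D (res D'' D' u) = res D'' D u ;

  resL : forall D' D : subdomain Om, {linear Ls D' -> Ls D} ;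
  resL_norm : forall D' D : subdomain Om, D `<=` D' ->
    forall u, `‖resL D' D u‖ <= `‖u‖ ;

  form : forall D, {sesquilinear (Hs D)} ;
  form_bounded : forall D, exists c, bounded_form (form D) c ;
  form_local : forall D D' : subdomain Om, D `<=` D' ->
    forall (u : Hs D') (v : H0s D),
      form D (res D' D u) (inc0 D v) = form D' u (inc0 D' (ext D D' v)) }.

Section Framework.
Variables (R : realType) (d : nat) (Om : lipschitzDomain R d).
Variable X : framework Om.

Definition HOm : hilbertType R := Hs X (whole Om).

Definition B : {sesquilinear HOm} := form X (whole Om).

Definition restr (D : subdomain Om) (u : HOm) : Hs X D := res X (whole Om) D u.

(* The identification of v in H_0(D) with its zero extension in H(Om). *)
Definition zext (D : subdomain Om) (v : H0s X D) : HOm :=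
  inc0 X (whole Om) (ext X D (whole Om) v).

Definition HB (D : subdomain Om) : set (Hs X D) :=
  [set u | forall v : H0s X D, form X D u (inc0 X D v) = 0].

End Framework.

Arguments HB {R d Om X} D _.

Section Seminorm.
Variables (R : realType) (V : lmodType R[i]) (b : V -> V -> R[i]).

Definition seminrm (u : V) : R := Num.sqrt (complex.Re (b u u)).

(* Completeness of (S / ker b, b): the quotient norm of the class of u is
   [seminrm u], so Cauchy sequences and limits are those of the seminorm. *)
Definition seminorm_complete (S : set V) :=
  forall u : nat -> V, (forall k, S (u k)) ->
    (forall e : R, 0 < e -> exists N : nat, forall p q : nat,
       (N <= p)%N -> (N <= q)%N -> seminrm (u p - u q) < e) ->
    exists2 v, S v & forall e : R, 0 < e -> exists N : nat, forall p : nat,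
       (N <= p)%N -> seminrm (u p - v) < e.

End Seminorm.

Record gfem (R : realType) (d : nat) (Om : lipschitzDomain R d)
    (X : framework Om) := Gfem {
  M : nat ;
  om : 'I_M -> subdomain Om ;
  oms : 'I_M -> subdomain Om ;
  om_cover : \bigcup_(i in [set: 'I_M]) (om i : set 'rV[R]_d) = Om ;
  om_oms : forall i, om i `<=` oms i ;

  P : forall i, {linear Hs X (om i) -> H0s X (om i)} ;
  P_bounded : forall i, bounded_op (P i) ;
  P_sum : forall u : HOm X, u = \sum_i zext (P i (restr (om i) u)) ;

  Bp : forall i, {hermitian_sym (Hs X (oms i)) for conjC} ;
  Bp_ge0 : forall i u, 0 <= Bp i u u ;

  K : forall i, set (Hs X (oms i)) ;
  l : 'I_M -> nat ;
  K_sub : forall i, @K i `<=` HB (oms i) ;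
  K_dim : forall i, has_dim (@K i) (l i) ;
  K_kernel : forall i v, (forall w, Bp i v w = 0) <-> @K i v ;

  (* (H_B / K_i, B+) is a Hilbert space, B+ being, like the other forms, bounded
     for the norm of H (needed on H_B only). *)
  Bp_complete : forall i, seminorm_complete (Bp i) (HB (oms i)) ;
  Bp_bounded : forall i, exists c : R,
    forall u, HB (oms i) u -> seminrm (Bp i) u <= c * `‖u‖ ;

  Phat_inj : forall i u v, @K i u -> @K i v ->
    P i (res X (oms i) (om i) u) = P i (res X (oms i) (om i) v) -> u = v ;
  Phat_compact : forall i,
    precompact [set P i (res X (oms i) (om i) u)
               | u in [set u | HB (oms i) u /\ `‖u‖ <= 1]] }.

Arguments om {R d Om X} g i.
Arguments oms {R d Om X} g i.
Arguments P {R d Om X} g i.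
Arguments Bp {R d Om X} g i.
Arguments K {R d Om X} g i _.
Arguments l {R d Om X} g i.

Section Gfem.
Variables (R : realType) (d : nat) (Om : lipschitzDomain R d).
Variables (X : framework Om) (G : gfem X).

Definition Phat (i : 'I_(M G)) (u : Hs X (oms G i)) : H0s X (om G i) :=
  P G i (res X (oms G i) (om G i) u).

Definition HB0 (i : 'I_(M G)) : set (Hs X (oms G i)) :=
  [set v | HB (oms G i) v /\ forall w, K G i w -> ⟪Phat v, Phat w⟫ = 0].

Arguments HB0 i _ : clear implicits.

Definition eigenpair (i : 'I_(M G)) (lam : \bar R) (phi : Hs X (oms G i)) :=
  [/\ HB (oms G i) phi, phi <> 0 &
      match lam with
      | r%:E => forall v, HB (oms G i) v ->
                  ⟪Phat phi, Phat v⟫ = r%:C * Bp G i phi v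
      | +oo%E => K G i phi
      | -oo%E => False
      end].

(* [(lam j, phi j)], j < n, are the first n eigenpairs in non-ascending order,
   counted with multiplicity: when index j is reached, the eigenspaces of all
   eigenvalues greater than [lam j] are exhausted.  In particular the first
   [l i] of the [phi j] span [K i]. *)
Definition first_eigenpairs (i : 'I_(M G)) (n : nat) (lam : 'I_n -> \bar R)
    (phi : 'I_n -> Hs X (oms G i)) :=
  [/\ forall j, eigenpair (lam j) (phi j),
      forall j k : 'I_n, (j <= k)%N -> (lam k <= lam j)%E,
      lin_indep phi &
      forall (j : 'I_n) (mu : \bar R) (v : Hs X (oms G i)),
        eigenpair mu v -> (lam j < mu)%E ->
        exists c : 'I_n -> R[i], v = \sum_(k < n | (k < j)%N) c k *: phi k].

Definition Sloc (i : 'I_(M G)) (n : nat) (phi : 'I_n -> Hs X (oms G i)) :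
    set (Hs X (om G i)) :=
  lin_span (fun j => res X (oms G i) (om G i) (phi j)).

Definition local_particular (F : HOm X -> R[i]) (i : 'I_(M G))
    (psi : Hs X (oms G i)) :=
  forall v : H0s X (oms G i),
    form X (oms G i) psi (inc0 X (oms G i) v) = F (zext v).

Definition upart (psi : forall i, Hs X (oms G i)) : HOm X :=
  \sum_i zext (Phat (psi i)).

Definition Sglob (n : 'I_(M G) -> nat)
    (phi : forall i, 'I_(n i) -> Hs X (oms G i)) : set (HOm X) :=
  [set u | exists f : forall i, Hs X (om G i),
     (forall i, Sloc (phi i) (f i)) /\ u = \sum_i zext (P G i (f i))].

Definition gfem_solution (F : HOm X -> R[i]) (psi : forall i, Hs X (oms G i))
    (n : 'I_(M G) -> nat) (phi : forall i, 'I_(n i) -> Hs X (oms G i))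
    (u : HOm X) :=
  (exists2 s, Sglob phi s & u = upart psi + s) /\
  (forall v, Sglob phi v -> B X u v = F v).

(* On HB0 the seminorm of B+ vanishes only at u = 0, where the quotient is
   0 / 0 = 0 and so does not affect the supremum. *)
Definition nwidth (n : nat) (i : 'I_(M G)) : \bar R :=
  ereal_inf [set ereal_sup
      [set ereal_inf [set (`‖Phat u - v‖ / seminrm (Bp G i) u)%:E | v in Q]
      | u in HB0 i]
    | Q in [set Q : set (H0s X (om G i)) | has_dim Q n]].

Definition dmax (n : 'I_(M G) -> nat) : \bar R :=
  \big[maxe/-oo%E]_(i < M G) nwidth (n i - l G i) i.

Definition coloring_constant (zeta : nat) :=
  exists color : 'I_(M G) -> 'I_zeta,
    forall j1 j2, j1 != j2 -> color j1 = color j2 ->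
      forall (u1 : H0s X (om G j1)) (u2 : H0s X (om G j2)),
        ⟪zext u1, zext u2⟫ = 0.

Definition overlap_bound (z : nat) :=
  (forall u : Ls X (whole Om),
     \sum_i `‖resL X (whole Om) (oms G i) u‖ ^+ 2 <= z%:R * `‖u‖ ^+ 2) /\
  (forall v : HOm X,
     \sum_i seminrm (Bp G i) (restr (oms G i) v) ^+ 2 <= z%:R * `‖v‖ ^+ 2).

Definition overlap_constant (z : nat) :=
  [/\ (0 < z)%N, overlap_bound z &
      forall z', (0 < z')%N -> overlap_bound z' -> (z <= z')%N].

(* Coercivity of B is assumed separately. *)
Definition elliptic_case (psi : forall i, Hs X (oms G i)) :=
  [/\ hermitian_form (B X),
      forall u, `‖u‖%:C ^+ 2 = B X u u,
      forall i u v, Bp G i u v = form X (oms G i) u v &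
      forall i, exists psi0 : H0s X (oms G i), psi i = inc0 X (oms G i) psi0].

End Gfem.

Arguments HB0 {R d Om X} G i _.
Arguments nwidth {R d Om X} G n i.
Arguments dmax {R d Om X} G n.

(* Main.v *)
Require Import Defs.
From HB Require Import structures.
From mathcomp Require Import all_boot all_order all_algebra sesquilinear.
From mathcomp Require Import all_classical all_reals all_analysis.
From mathcomp Require Import ring lra.
Set Implicit Arguments.
Unset Strict Implicit.
Unset Printing Implicit Defensive.
Import Order.TTheory GRing.Theory Num.Def Num.Theory.
Import numFieldNormedType.Exports.
Local Open Scope classical_set_scope.
Local Open Scope ring_scope.
Local Open Scope complex_scope.

(** The error of the Galerkin solution is controlled by the best approximation
    of the exact solution [ue] in [upart psi + Sglob phi]: Cea's lemma
    ([quasi_optimality]) in general, orthogonality for the energy product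
    ([energy_optimality]) in the elliptic case.  Since the operators [P i] add up
    to the identity, [ue - upart psi] is the sum of the [Phat w_i], where
    [w_i = ue|oms_i - psi_i] solves the local homogeneous problem.  It is
    therefore enough to approximate each [Phat w_i] by [Phat] of the span of the
    first [n_i] eigenvectors, and to glue the local errors by means of the
    coloring ([global_approximation]).  In the elliptic case [w_i] and [psi_i] are
    orthogonal, so that [w_i] is not larger than [ue|oms_i], and the squared
    seminorms of the latter add up to at most [zeta_s] times the squared norm of
    [ue].

    The local estimate ([local_approximation]) says that the spectral space is
    optimal for the n-width.  Write [T] for [Phat] and [b] for [B+], and let [w']
    be what remains of [w] after projection on the span of the eigenvectors
    [e_j].  The Rayleigh quotient of [T] is at least [r], the last eigenvalue, on
    this span ([span_rayleigh_ge]), and at most [r] at [w']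
    ([complement_rayleigh_le]).  Adding [w'] to the span thus gives a space on
    which the quotient is at least that of [w'], and whose dimension exceeds by
    one the number of conditions for orthogonality to [T K] and to a competing
    space of dimension [n - l].  Some nonzero vector [u] of it meets all these
    conditions ([span_width_witness]); then [T u] is its own distance to the
    competing space, which bounds the width from below by the ratio of the norm of
    [T w'] to the seminorm of [w'].

    That the quotient at [w'] does not exceed [r] is the variational principle: a
    larger supremum over the complement of the span would be attained
    ([rayleigh_maximizer]), by an eigenvector whose eigenvalue lies above [r] and
    which is not in the span of the [e_j], although the list is exhaustive above
    [r].  Attainment rests on compactness.  The operator is compact for the norm
    of [H], whereas a maximizing sequence is bounded for [b] only; the open mapping
    theorem, proved by Baire's argument for the complete seminormed space
    ([bounded_representative]), provides representatives modulo [K] that are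
    bounded in norm. *)

(** * Norms as real numbers *)

Section Nrm.
Variables (R : realType) (V : normedZmodType R[i]).
Implicit Types x y : V.

Lemma normE x : `|x| = (`‖x‖)%:C.
Proof. by rewrite RRe_real// normr_real. Qed.

Lemma nrm_ge0 x : 0 <= `‖x‖.
Proof. by rewrite -ler0c -normE. Qed.

Lemma nrm0 : `‖(0 : V)‖ = 0.
Proof. by rewrite /nrm normr0. Qed.

Lemma nrm_eq0 x : (`‖x‖ == 0) = (x == 0).
Proof.
rewrite -[RHS]normr_eq0 normE; apply/eqP/eqP => [->//|h].
by have := congr1 (@complex.Re R) h.
Qed.

Lemma nrmD x y : `‖x + y‖ <= `‖x‖ + `‖y‖.
Proof. by rewrite -lecR rmorphD/= -!normE ler_normD. Qed.

Lemma nrmN x : `‖- x‖ = `‖x‖.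
Proof. by rewrite /nrm normrN. Qed.

Lemma nrmB x y : `‖x - y‖ = `‖y - x‖.
Proof. by rewrite /nrm distrC. Qed.

End Nrm.

Lemma nrmZ (R : realType) (V : normedModType R[i]) (a : R[i]) (x : V) :
  `‖a *: x‖ = `‖a‖ * `‖x‖.
Proof. by apply: complexI; rewrite rmorphM/= -!normE normrZ. Qed.

Section Cplx.
Variable (R : realType).
Implicit Types z w : R[i].

Lemma nrm_real (r : R) : `‖r%:C‖ = `|r|.
Proof. by rewrite /nrm normc_def /= expr0n addr0 sqrtr_sqr. Qed.

Lemma ReD z w : complex.Re (z + w) = complex.Re z + complex.Re w.
Proof. by case: z; case: w. Qed.

Lemma ReZ (r : R) z : complex.Re (r%:C * z) = r * complex.Re z.
Proof. by case: z => a b /=; rewrite mul0r subr0. Qed.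

Lemma Re_conj z : complex.Re (conjC z) = complex.Re z.
Proof. by case: z. Qed.

Lemma conjC_real (r : R) : conjC r%:C = r%:C.
Proof. exact: conjc_real. Qed.

Lemma nrmM z w : `‖z * w‖ = `‖z‖ * `‖w‖.
Proof. by apply: complexI; rewrite rmorphM/= -!normE normrM. Qed.

Lemma mul_conjC z : z * conjC z = (`‖z‖ ^+ 2)%:C.
Proof. by rewrite -normCK normE rmorphXn. Qed.

Lemma Re_le_nrm z : complex.Re z <= `‖z‖.
Proof.
rewrite /nrm normc_def /=; apply: (le_trans (ler_norm _)).
by rewrite -sqrtr_sqr ler_wsqrtr// lerDl sqr_ge0.
Qed.

End Cplx.

(** * Semidefinite Hermitian forms *)

Section SemiForm.
Variables (R : realType) (V : lmodType R[i]).

Definition subspace (S : set V) :=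
  S 0 /\ forall a u v, S u -> S v -> S (a *: u + v).

Lemma subspaceD S u v : subspace S -> S u -> S v -> S (u + v).
Proof. by move=> [_ h] Su Sv; rewrite -[u]scale1r; exact: h. Qed.

Lemma subspaceZ S a u : subspace S -> S u -> S (a *: u).
Proof. by move=> [S0 h] Su; rewrite -[_ *: _]addr0; exact: h. Qed.

Lemma subspaceN S u : subspace S -> S u -> S (- u).
Proof. by move=> hS Su; rewrite -scaleN1r; exact: subspaceZ. Qed.

Lemma subspaceB S u v : subspace S -> S u -> S v -> S (u - v).
Proof. by move=> hS Su Sv; apply: subspaceD => //; exact: subspaceN. Qed.

Lemma subspace_sum S (I : finType) (P : pred I) (e : I -> V) :
  subspace S -> (forall i, P i -> S (e i)) -> S (\sum_(i | P i) e i).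
Proof.
move=> hS h; apply: (big_ind S) => //; first by case: hS.
by move=> u v; exact: subspaceD.
Qed.

Lemma subspace_comb S (I : finType) (e : I -> V) (c : I -> R[i]) :
  subspace S -> (forall i, S (e i)) -> S (\sum_i c i *: e i).
Proof. by move=> hS h; apply: subspace_sum => // i _; exact: subspaceZ. Qed.

Lemma subspace_span (I : finType) (e : I -> V) : subspace (lin_span e).
Proof.
split; first by exists (fun=> 0); rewrite big1// => i _; rewrite scale0r.
move=> a u v [c ->] [c' ->]; exists (fun i => a * c i + c' i).
rewrite scaler_sumr -big_split/=; apply: eq_bigr => i _.
by rewrite scalerDl scalerA.
Qed.

(** Relative to a set, because a form [mu b - ⟪T _, T _⟫] becomes semidefinite only
    on the subspace where [mu] bounds the Rayleigh quotient. *)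
Definition psd_on (S : set V) (b : V -> V -> R[i]) :=
  forall u, S u -> 0 <= complex.Re (b u u).

Variable b : {hermitian_sym V for conjC}.

Lemma form_sym u v : b u v = conjC (b v u).
Proof. by rewrite hermC mul1r. Qed.

Lemma form_real u : b u u = (complex.Re (b u u))%:C.
Proof.
have := form_sym u u; case: (b u u) => x y [] /= /eqP.
by rewrite -subr_eq0 opprK -mulr2n mulrn_eq0/= => /eqP ->.
Qed.

Lemma form_sumr (I : finType) (c : I -> R[i]) (e : I -> V) u :
  b u (\sum_i c i *: e i) = \sum_i conjC (c i) * b u (e i).
Proof. by rewrite linear_sumr; apply: eq_bigr => i _; rewrite linearZr_LR. Qed.

Lemma form_suml (I : finType) (c : I -> R[i]) (e : I -> V) u :
  b (\sum_i c i *: e i) u = \sum_i c i * b (e i) u.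
Proof. by rewrite linear_sumlz; apply: eq_bigr => i _; rewrite linearZl_LR. Qed.

Lemma qformD u v : complex.Re (b (u + v) (u + v)) =
  complex.Re (b u u) + complex.Re (b v v) + 2 * complex.Re (b u v).
Proof.
rewrite linearDl !linearDr /= (form_sym v u) !ReD Re_conj.
by rewrite -!addrA; congr (_ + _); ring.
Qed.

Lemma qformZ a u :
  complex.Re (b (a *: u) (a *: u)) = `‖a‖ ^+ 2 * complex.Re (b u u).
Proof.
by rewrite linearZl_LR linearZr_LR /= mulrA mul_conjC ReZ.
Qed.

Lemma qformN u : complex.Re (b (- u) (- u)) = complex.Re (b u u).
Proof. by rewrite hnormN. Qed.

Lemma qformB u v : complex.Re (b (u - v) (u - v)) =
  complex.Re (b u u) + complex.Re (b v v) - 2 * complex.Re (b u v).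
Proof.
rewrite qformD qformN linearNr -[- _ as X in complex.Re X]mulN1r.
by rewrite -(rmorphN1 (real_complex R)) ReZ mulN1r mulrN.
Qed.

Lemma qformD_orth u v : b u v = 0 -> complex.Re (b (u + v) (u + v)) =
  complex.Re (b u u) + complex.Re (b v v).
Proof. by move=> h; rewrite qformD h mulr0 addr0. Qed.

Variable S : set V.
Hypothesis hS : subspace S.
Hypothesis b_ge0 : psd_on S b.

Lemma seminrm_sqr u : S u -> seminrm b u ^+ 2 = complex.Re (b u u).
Proof. by move=> Su; rewrite sqr_sqrtr// b_ge0. Qed.

Lemma seminrm_ge0 u : 0 <= seminrm b u.
Proof. exact: sqrtr_ge0. Qed.

Lemma seminrmZ a u : seminrm b (a *: u) = `‖a‖ * seminrm b u.
Proof.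
by rewrite /seminrm qformZ sqrtrM ?sqr_ge0// sqrtr_sqr ger0_norm// nrm_ge0.
Qed.

Lemma seminrmN u : seminrm b (- u) = seminrm b u.
Proof. by rewrite /seminrm qformN. Qed.

Lemma seminrmB u v : seminrm b (u - v) = seminrm b (v - u).
Proof. by rewrite -seminrmN opprB. Qed.

Lemma seminrm0 : seminrm b 0 = 0.
Proof. by rewrite /seminrm linear0r sqrtr0. Qed.

(** The form at [u - (s * b u v) *: v] is a real quadratic polynomial in the
    real number [s]; it is nonnegative, so its discriminant is not positive. *)
Lemma cauchy_schwarz u v : S u -> S v ->
  `‖b u v‖ ^+ 2 <= complex.Re (b u u) * complex.Re (b v v).
Proof.
move=> Su Sv; set x := `‖b u v‖ ^+ 2.
have key s : 0 <= complex.Re (b u u) - 2 * s * x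
                  + s ^+ 2 * x * complex.Re (b v v).
  have /b_ge0 : S (u - (s%:C * b u v) *: v).
    by apply: subspaceB => //; exact: subspaceZ.
  rewrite qformB qformZ linearZr_LR /= rmorphM /= conjC_real.
  rewrite -(mulrA s%:C) (mulrC (conjC (b u v))) mul_conjC ReZ /= nrmM exprMn nrm_real.
  by rewrite real_normK ?num_real// -/x; congr (_ <= _); ring.
have x0 : 0 <= x by exact: sqr_ge0.
have [v0|vN0] := eqVneq (complex.Re (b v v)) 0.
  rewrite v0 mulr0; have := key ((1 + complex.Re (b u u)) / (2 * x)).
  have [->|xN0] := eqVneq x 0; first by [].
  rewrite v0 mulr0 addr0; set y := complex.Re _.
  have -> : y - 2 * ((1 + y) / (2 * x)) * x = - 1 by field.
  by move=> h; lra.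
have v1 : 0 < complex.Re (b v v) by rewrite lt_neqAle eq_sym vN0 b_ge0.
have := key (complex.Re (b v v))^-1.
set y := complex.Re (b u u); set z := complex.Re (b v v).
rewrite -/z in vN0.
have -> : y - 2 * z^-1 * x + z^-1 ^+ 2 * x * z = (y * z - x) / z by field.
by rewrite pmulr_lge0 ?invr_gt0// subr_ge0.
Qed.

Lemma cauchy_schwarz_seminrm u v : S u -> S v ->
  `‖b u v‖ <= seminrm b u * seminrm b v.
Proof.
move=> Su Sv; rewrite -ler_sqr ?nnegrE ?mulr_ge0 ?seminrm_ge0 ?nrm_ge0//.
by rewrite exprMn !seminrm_sqr//; exact: cauchy_schwarz.
Qed.

Lemma form_null u v : S u -> S v -> seminrm b u = 0 -> b u v = 0.
Proof.
move=> Su Sv u0; apply/eqP; rewrite -nrm_eq0 eq_le nrm_ge0 andbT.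
by apply: (le_trans (cauchy_schwarz_seminrm Su Sv)); rewrite u0 mul0r.
Qed.

Lemma seminrmD u v : S u -> S v ->
  seminrm b (u + v) <= seminrm b u + seminrm b v.
Proof.
move=> Su Sv; rewrite -ler_sqr ?nnegrE ?addr_ge0 ?seminrm_ge0//.
rewrite sqrrD !seminrm_sqr//; last exact: subspaceD.
have := le_trans (Re_le_nrm _) (cauchy_schwarz_seminrm Su Sv).
by rewrite qformD -mulr_natl; lra.
Qed.

(** Gram-Schmidt.  In a semidefinite space a residual of seminorm zero is
    orthogonal to everything, so it can be skipped. *)
Lemma orthogonal_residual n (e : 'I_n -> V) x : (forall i, S (e i)) -> S x ->
  exists c : 'I_n -> R[i], forall j, b (x - \sum_i c i *: e i) (e j) = 0.
Proof.
elim: n e x => [|n IH] e x Se Sx; first by exists (fun=> 0) => -[].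
pose e' i := e (lift ord0 i); have Se' i : S (e' i) by exact: Se.
have [c hc] := IH e' _ Se' Sx; have [d hd] := IH e' _ Se' (Se ord0).
set y := x - _ in hc; set f := e ord0 - _ in hd.
have Sy : S y by apply: subspaceB => //; exact: subspace_comb.
have Sf : S f by apply: subspaceB => //; exact: subspace_comb.
pose t := if seminrm b f == 0 then 0 else b y f / b f f.
have tf : b (y - t *: f) f = 0.
  rewrite linearBl linearZl_LR /= /t; case: eqP => [f0|/eqP f0].
    by rewrite mul0r subr0 form_sym form_null// conjC0.
  rewrite mulrVK ?subrr// unitfE form_real.
  by rewrite -seminrm_sqr// -(rmorph0 (real_complex R)) (inj_eq (@complexI _)) sqrf_eq0.
exists (fun i => if unlift ord0 i is Some k then c k - t * d k else t).
have -> : x - \sum_i (if unlift ord0 i is Some k then c k - t * d k else t) *: e i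
    = y - t *: f.
  rewrite big_ord_recl unlift_none.
  under eq_bigr do rewrite liftK scalerBl -scalerA.
  by rewrite sumrB -scaler_sumr /y /f scalerBr addrCA opprD addrA.
have h k : b (y - t *: f) (e' k) = 0.
  by rewrite linearBl linearZl_LR /= hc hd mulr0 subrr.
move=> j; case: (unliftP ord0 j) => [k ->|->]; first exact: h.
have -> : e ord0 = f + \sum_i d i *: e' i by rewrite subrK.
rewrite linearDr /= tf add0r form_sumr big1// => i _.
by rewrite h mulr0.
Qed.

End SemiForm.

(** * Bounded representatives in a complete seminormed quotient *)

Section Sequences.
Variable R : realType.

Lemma geometric_lt (a e : R) : 0 < e -> exists N, a * 2^-1 ^+ N < e.
Proof.
move=> e0; have [a0|a0] := leP a 0.
  by exists 0%N; rewrite expr0 mulr1; exact: le_lt_trans e0.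
have := archi_boundP (divr_ge0 (ltW a0) (ltW e0)).
set N := Num.bound _ => hN; exists N.
rewrite exprVn ltr_pdivrMr ?exprn_gt0// mulrC -ltr_pdivrMr//.
by apply: (lt_trans hN); rewrite -natrX ltr_nat ltn_expl.
Qed.

Lemma nrm_complete (V : completeNormedModType R[i]) (S : set V) (u : nat -> V) :
  closed S -> (forall k, S (u k)) ->
  (forall e : R, 0 < e -> exists N, forall p q : nat,
     (N <= p)%N -> (N <= q)%N -> `‖u p - u q‖ < e) ->
  exists2 v, S v & forall e : R, 0 < e -> exists N, forall p : nat,
     (N <= p)%N -> `‖u p - v‖ < e.
Proof.
move=> Scl Su hu.
have eE (e : R[i]) : 0 < e -> e = (complex.Re e)%:C /\ 0 < complex.Re e.
  move=> e0; have h : e = (complex.Re e)%:C by rewrite RRe_real// gtr0_real.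
  by split=> //; rewrite -ltcR -h.
have cu : cvg (u @ \oo).
  apply: cauchy_cvg; apply: cauchy_exP => e /eE [-> e0].
  have [N hN] := hu _ e0; exists (u N); exists N => // n /= Nn.
  by rewrite -ball_normE /= normE ltcR; apply: hN.
have /cvg_ex [v cv] := cu.
exists v.
  by apply: (closed_cvg _ Scl _ _ cv); exists 0%N => // n _; exact: Su.
move=> e e0; have /cvgrPdist_lt/(_ e%:C) := cv; rewrite (ltcR 0 e) => /(_ e0) [N _ hN].
by exists N => p /hN /=; rewrite normE ltcR nrmB.
Qed.

End Sequences.

Section OpenMapping.
Variables (R : realType) (V : completeNormedModType R[i]).
Variables (b : {hermitian_sym V for conjC}) (S : set V) (c : R).
Hypotheses (hS : subspace S) (Scl : closed S) (b_ge0 : psd_on S b).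
Hypotheses (b_complete : seminorm_complete b S)
  (b_bounded : forall u, S u -> seminrm b u <= c * `‖u‖).

Let p := seminrm b.

Let pD u v : S u -> S v -> p (u + v) <= p u + p v.
Proof. exact: seminrmD hS b_ge0 u v. Qed.

Let pB u v w : S u -> S v -> S w -> p (u - w) <= p (u - v) + p (v - w).
Proof.
move=> Su Sv Sw; have -> : u - w = (u - v) + (v - w) by rewrite addrA subrK.
by apply: pD; apply: subspaceB.
Qed.

(** Baire's argument: were no norm ball dense in a seminorm ball, nested
    seminorm balls avoiding the norm balls of radius 0, 1, 2, ... would shrink to
    a vector of infinite norm. *)
Lemma norm_ball_dense : exists N : nat, exists x r, [/\ S x, 0 < r &
  forall y, S y -> p (y - x) < r -> forall e, 0 < e ->
    exists z, [/\ S z, `‖z‖ <= N%:R & p (y - z) < e]].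
Proof.
apply: contrapT => noball.
have step N (xr : V * R) : exists yr : V * R, S xr.1 -> 0 < xr.2 ->
    [/\ S yr.1, 0 < yr.2, yr.2 <= xr.2 / 2, p (yr.1 - xr.1) <= xr.2 / 2 &
      forall z, S z -> `‖z‖ <= N%:R -> 2 * yr.2 <= p (yr.1 - z)].
  have [[Sx r0]|h] := pselect (S xr.1 /\ 0 < xr.2); last first.
    by exists xr => Sx r0; case: h.
  apply: contrapT => nostep; apply: noball; exists N, xr.1, (xr.2 / 2).
  split=> //; first by rewrite divr_gt0.
  move=> y Sy yr e e0; apply: contrapT => noz; apply: nostep.
  exists (y, Num.min (xr.2 / 2) (e / 2)) => _ _ /=; split=> //.
  - by rewrite lt_min !divr_gt0.
  - by rewrite ge_min lexx.
  - exact: ltW.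
  - move=> z Sz zN; have : e / 2 * 2 <= p (y - z).
      by rewrite divfK// leNgt; apply/negP => h; apply: noz; exists z.
    by apply: le_trans; rewrite mulrC ler_wpM2r// ge_min lexx orbT.
have [f hf] := choice (fun a : nat * (V * R) => step a.1 a.2).
pose s := fix s k : V * R := if k is k'.+1 then f (k', s k') else (0, 1).
have hs k : S (s k).1 /\ 0 < (s k).2.
  elim: k => [|k [Sk rk]]; first by split=> //; case: hS.
  by case: (hf (k, s k) Sk rk).
have hstep k : [/\ (s k.+1).2 <= (s k).2 / 2,
    p ((s k.+1).1 - (s k).1) <= (s k).2 / 2 &
    forall z, S z -> `‖z‖ <= k%:R -> 2 * (s k.+1).2 <= p ((s k.+1).1 - z)].
  by have [Sk rk] := hs k; case: (hf (k, s k) Sk rk).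
have rlt k : (s k).2 <= 2^-1 ^+ k.
  elim: k => [|k IH]; first by rewrite expr0.
  have [h _ _] := hstep k; apply: (le_trans h).
  by rewrite exprS mulrC ler_wpM2l ?invr_ge0.
have tail m k : p ((s (m + k)%N).1 - (s m).1) <= (s m).2 - (s (m + k)%N).2.
  elim: k => [|k IH]; first by rewrite addn0 !subrr /p seminrm0.
  have [h1 h2 _] := hstep (m + k)%N; rewrite addnS.
  apply: (le_trans (pB (hs _).1 (hs (m + k)%N).1 (hs m).1)).
  by move: h1 h2 IH; lra.
have tail' m k : (m <= k)%N -> p ((s k).1 - (s m).1) <= (s m).2.
  move=> mk; have := tail m (k - m)%N; rewrite subnKC// => h.
  by have := (hs k).2; move: h; lra.
have [|x Sx hx] := b_complete (fun k => (hs k).1).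
  move=> e e0; have [N hN] := geometric_lt 2 e0; exists N => k l Nk Nl.
  have := tail' _ _ Nk; have := tail' _ _ Nl; have := rlt N.
  have := pB (hs k).1 (hs N).1 (hs l).1.
  by rewrite /p [seminrm b ((s N).1 - _)]seminrmB -/p; move: hN; lra.
have xlim k : p ((s k).1 - x) <= (s k).2.
  apply/ler_addgt0Pr => e e0; have [N hN] := hx _ e0.
  have := hN (maxn N k) (leq_maxl _ _); have := tail' _ _ (leq_maxr N k).
  have := pB (hs k).1 (hs (maxn N k)).1 Sx.
  by rewrite /p [seminrm b ((s k).1 - (s _).1)]seminrmB -/p; lra.
have := archi_boundP (nrm_ge0 x); set N := Num.bound _ => xN.
have [_ _ /(_ _ Sx (ltW xN))] := hstep N; have := xlim N.+1.
by have := (hs N.+1).2; lra.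
Qed.

(** Differences of points of the ball of [norm_ball_dense] cover a seminorm ball
    around 0, and homogeneity extends the approximation to all radii. *)
Lemma approximate_representative : exists2 C : R, 0 <= C &
  forall t, 0 < t -> forall u, S u -> p u < t -> forall e, 0 < e ->
    exists y, [/\ S y, `‖y‖ <= C * t & p (u - y) < e].
Proof.
have [N [x [r [Sx r0 dense]]]] := norm_ball_dense.
exists (2 * N%:R / r); first by apply: divr_ge0; [exact: mulr_ge0|exact: ltW].
move=> t t0 u Su ut e e0.
pose a := r / t; have a0 : 0 < a by rewrite divr_gt0.
have na : `‖a%:C‖ = a by rewrite nrm_real gtr0_norm.
have ae : 0 < a * e / 2 by rewrite divr_gt0// mulr_gt0.
have Sau : S (a%:C *: u) by exact: subspaceZ.
have [||z [Sz zN hz]] := dense (x + a%:C *: u) _ _ _ ae.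
- exact: subspaceD.
- by rewrite addrC addKr /p seminrmZ na -/p /a mulrAC ltr_pdivrMr// ltr_pM2l.
have [|z' [Sz' zN' hz']] := dense x Sx _ _ ae.
- by rewrite subrr /p seminrm0.
exists (a^-1%:C *: (z - z')); split.
- by apply: subspaceZ => //; exact: subspaceB.
- rewrite nrmZ nrm_real gtr0_norm ?invr_gt0//.
  have : `‖z - z'‖ <= 2 * N%:R.
    by apply: (le_trans (nrmD _ _)); rewrite nrmN; lra.
  rewrite /a invf_div => h.
  have -> : 2 * N%:R / r * t = t / r * (2 * N%:R) by field; exact: lt0r_neq0.
  by rewrite ler_wpM2l// divr_ge0 ?ltW.
have -> : u - a^-1%:C *: (z - z') =
    a^-1%:C *: ((x + a%:C *: u - z) - (x - z')).
  have -> : x + a%:C *: u - z - (x - z') = a%:C *: u - (z - z').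
    rewrite opprB [x + _]addrC -!addrA; congr (_ + _).
    by rewrite opprB addrCA [x + _]addrC subrK addrC.
  by rewrite [RHS]scalerBr scalerA -rmorphM /= mulVf ?lt0r_neq0// scale1r.
rewrite /p seminrmZ nrm_real gtr0_norm ?invr_gt0// mulrC ltr_pdivrMr//.
have := seminrmD hS b_ge0 (subspaceB hS (subspaceD hS Sx Sau) Sz)
  (subspaceN hS (subspaceB hS Sx Sz')).
by rewrite seminrmN -/p; move: hz hz'; lra.
Qed.

(** The open mapping theorem for the quotient map from [S], with its norm, onto
    [S / ker b], with the seminorm: approximate representatives of the successive
    residuals form a series that converges in norm. *)
Theorem bounded_representative : exists2 C : R, 0 < C & forall u, S u ->
  exists u', [/\ S u', p (u - u') = 0 & `‖u'‖ <= C * p u].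
Proof.
have [C C0 approx] := approximate_representative.
exists (4 * C + 1) => [|u Su]; first by lra.
have [pu0|puN0] := eqVneq (p u) 0.
  exists 0; split; [by case: hS|by rewrite subr0|].
  by rewrite nrm0 pu0 mulr0.
have pu : 0 < p u by rewrite lt_neqAle eq_sym puN0 seminrm_ge0.
pose t k := 2 * p u * 2^-1 ^+ k.
have t0 k : 0 < t k by rewrite !mulr_gt0// exprn_gt0// invr_gt0.
have tS k : t k.+1 = t k / 2 by rewrite /t exprSr mulrA.
have step (a : nat * V) : exists y, S a.2 -> p a.2 < t a.1 ->
    [/\ S y, `‖y‖ <= C * t a.1 & p (a.2 - y) < t a.1.+1].
  have [[Sz pz]|h] := pselect (S a.2 /\ p a.2 < t a.1); last first.
    by exists 0 => Sz pz; case: h.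
  by have [y hy] := approx _ (t0 _) _ Sz pz _ (t0 a.1.+1); exists y.
have [f hf] := choice step.
pose z := fix z k := if k is k'.+1 then z k' - f (k', z k') else u.
have hz k : S (z k) /\ p (z k) < t k.
  elim: k => [|k [Sk pk]]; first by split=> //; rewrite /t expr0 mulr1; lra.
  by case: (hf (k, z k) Sk pk) => Sy _ h; split=> //; exact: subspaceB.
have hstep k : `‖z k - z k.+1‖ <= C * t k.
  have [Sk pk] := hz k; have [_ h _] := hf (k, z k) Sk pk.
  by rewrite /= opprB addrC subrK.
have tail m k : `‖z m - z (m + k)%N‖ <= 2 * C * t m - 2 * C * t (m + k)%N.
  elim: k => [|k IH]; first by rewrite addn0 !subrr nrm0.
  have -> : z m - z (m + k.+1)%N =
      (z m - z (m + k)%N) + (z (m + k)%N - z (m + k).+1).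
    by rewrite addrA subrK addnS.
  apply: (le_trans (nrmD _ _)); have := hstep (m + k)%N.
  by rewrite addnS tS; move: IH; lra.
have tail' m k : (m <= k)%N -> `‖z m - z k‖ <= 2 * C * t m.
  move=> mk; have := tail m (k - m)%N; rewrite subnKC// => h.
  have : 0 <= 2 * C * t k by rewrite !mulr_ge0// ltW.
  by move: h; lra.
have Ss k : S (u - z k) by apply: subspaceB => //; case: (hz k).
have [|v Sv hv] := nrm_complete Scl Ss.
  move=> e e0; have [N hN] := geometric_lt (8 * C * p u) e0; exists N => k l Nk Nl.
  have -> : u - z k - (u - z l) = (z N - z k) - (z N - z l).
    have E (x y w : V) : (w - x) - (w - y) = y - x.
      by rewrite opprB addrC addrA subrK.
    by rewrite !E.
  apply: (le_lt_trans (nrmD _ _)); rewrite nrmN.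
  have := tail' _ _ Nk; have := tail' _ _ Nl; move: hN; rewrite /t.
  set q := 2^-1 ^+ N; have -> : 2 * C * (2 * p u * q) = 4 * C * p u * q by ring.
  have -> : 8 * C * p u * q = 2 * (4 * C * p u * q) by ring.
  lra.
exists v; split=> //.
  apply/eqP; rewrite eq_le seminrm_ge0 andbT; apply/ler_addgt0Pr => e e0.
  rewrite add0r.
  have e2 : 0 < e / 2 by rewrite divr_gt0.
  have c1 : 0 < `|c| + 1 by rewrite ltr_wpDl.
  have [N hN] := geometric_lt (2 * p u) e2.
  have [N' hN'] := hv _ (divr_gt0 e2 c1).
  pose k := maxn N N'.
  have := pB Su (Ss k) Sv.
  have -> : u - (u - z k) = z k by rewrite opprB addrC subrK.
  move/le_trans; apply.
  have tk : t k < e / 2.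
    apply: le_lt_trans hN; rewrite ler_pM2l ?mulr_gt0//.
    by rewrite ler_wiXn2l ?invr_ge0 ?invf_le1 ?ler1n// leq_maxl.
  have h1 := b_bounded (subspaceB hS (Ss k) Sv).
  have := hN' k (leq_maxr _ _); rewrite ltr_pdivlMr// => h2.
  have h3 : c * `‖u - z k - v‖ <= `‖u - z k - v‖ * (`|c| + 1).
    rewrite mulrC ler_wpM2l ?nrm_ge0//.
    by apply: (le_trans (ler_norm _)); rewrite lerDl.
  by have [_ pk] := hz k; move: h1 h2 h3 pk tk; rewrite /p; lra.
apply/ler_addgt0Pr => e e0; have [N hN] := hv _ e0.
have := hN N (leqnn _); have := tail' 0%N N (leq0n _).
have vE : v = (z 0%N - z N) - (u - z N - v) by rewrite /= opprB addrC subrK.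
move=> h1 h2; rewrite {1}vE; apply: (le_trans (nrmD _ _)); rewrite nrmN.
have tE : t 0%N = 2 * p u by rewrite /t expr0 mulr1.
by move: h1 h2 pu; rewrite tE; lra.
Qed.

End OpenMapping.

(** * Existence of a maximizer of the Rayleigh quotient *)

Section Pencil.
Variables (R : realType) (V : lmodType R[i]) (W : hilbertType R).
Variables (b : {hermitian_sym V for conjC}) (T : {linear V -> W}) (m s : R).

(** The forms [⟪T _, T _⟫] (0, 1), [b + ⟪T _, T _⟫] (1, 1) and [mu b - ⟪T _, T _⟫]
    ([mu], -1) are all needed as Hermitian forms. *)
Definition pencil (u v : V) : R[i] := m%:C * b u v + s%:C * ⟪T u, T v⟫.

Lemma pencil_bilinear : bilinear_for *%R (conjC \; *%R) pencil.
Proof.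
split=> w a u v; rewrite /pencil (linearP T).
  rewrite (linearDl b) (linearZl_LR b) (linearDl (hdot W)) (linearZl_LR (hdot W)).
  by rewrite /= !mulrDr addrACA (mulrCA m%:C) (mulrCA s%:C).
rewrite (linearDr b) (linearZr_LR b) (linearDr (hdot W)) (linearZr_LR (hdot W)).
by rewrite /= !mulrDr addrACA (mulrCA m%:C) (mulrCA s%:C).
Qed.

Lemma pencil_hermitian u v : pencil u v = (-1) ^+ false * conjC (pencil v u).
Proof.
rewrite /pencil mul1r rmorphD /= !rmorphM /= !conjC_real.
by rewrite -form_sym -form_sym.
Qed.

HB.instance Definition _ := bilinear_isBilinear.Build R[i] V V R[i]
  *%R (conjC \; *%R) pencil pencil_bilinear.
HB.instance Definition _ := isHermitianSesquilinear.Build R[i] V false conjC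
  pencil pencil_hermitian.

End Pencil.

Section Hilb.
Variables (R : realType) (W : hilbertType R).
Implicit Types x y : W.

Lemma hdot_sym x y : ⟪x, y⟫ = conjC ⟪y, x⟫.
Proof. exact: form_sym. Qed.

Lemma hdotDr x y z : ⟪x, y + z⟫ = ⟪x, y⟫ + ⟪x, z⟫.
Proof. exact: linearDr. Qed.

Lemma hdot_suml (I : finType) (c : I -> R[i]) (e : I -> W) x :
  ⟪\sum_i c i *: e i, x⟫ = \sum_i c i * ⟪e i, x⟫.
Proof. exact: (form_suml (hdot W)). Qed.

Lemma hdot_sumr (I : finType) (c : I -> R[i]) (e : I -> W) x :
  ⟪x, \sum_i c i *: e i⟫ = \sum_i conjC (c i) * ⟪x, e i⟫.
Proof. exact: (form_sumr (hdot W)). Qed.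

Lemma hdot_nrm x : complex.Re ⟪x, x⟫ = `‖x‖ ^+ 2.
Proof. by rewrite hdot_norm normE -rmorphXn. Qed.

Lemma nrm_le_orth x y : ⟪x, y⟫ = 0 -> `‖x‖ <= `‖x - y‖.
Proof.
move=> xy; rewrite -ler_sqr ?nnegrE ?nrm_ge0// -!hdot_nrm.
have xy' : ⟪x, - y⟫ = 0 by rewrite linearNr -[LHS]/(- ⟪x, y⟫) xy oppr0.
by rewrite (qformD_orth xy') lerDl hdot_nrm sqr_ge0.
Qed.

Lemma nrmD_orth x y : ⟪x, y⟫ = 0 -> `‖x + y‖ ^+ 2 = `‖x‖ ^+ 2 + `‖y‖ ^+ 2.
Proof. by move=> xy; rewrite -!hdot_nrm (qformD_orth xy). Qed.

End Hilb.

Lemma Re_pencil (R : realType) (V : lmodType R[i]) (W : hilbertType R)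
   (b : {hermitian_sym V for conjC}) (T : {linear V -> W}) m s u :
  complex.Re (pencil b T m s u u) =
  m * complex.Re (b u u) + s * `‖T u‖ ^+ 2.
Proof. by rewrite /pencil ReD !ReZ hdot_nrm. Qed.

Section Seq.
Variable R : realType.

Lemma precompact_cluster (W : normedModType R[i]) (A : set W) (y : nat -> W) :
  precompact A -> (forall k, A (y k)) ->
  exists z, forall e : R, 0 < e -> forall j, exists2 k, (j <= k)%N & `‖y k - z‖ < e.
Proof.
move=> [U AU [cU _]] Ay.
have [z [_ hz]] : U `&` cluster (y @ \oo) !=set0.
  by apply: cU; exists 0%N => // n _; apply: AU; exact: Ay.
exists z => e e0 j.
have [||_ [[k jk <-]]] := hz [set y k | k in [set k | (j <= k)%N]] (ball z e%:C) _ _.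
- by exists j => // k jk; exists k.
- by apply: nbhsx_ballx; rewrite ltcR.
rewrite -ball_normE /= normE ltcR => h.
by exists k => //; rewrite nrmB.
Qed.

End Seq.

Section Spectral.
Variables (R : realType) (V : completeNormedModType R[i]) (W : hilbertType R).
Variables (T : {linear V -> W}) (b : {hermitian_sym V for conjC}).
Variables (S K : set V) (c cT : R).
Hypotheses (hS : subspace S) (Scl : closed S) (b_ge0 : psd_on setT b).
Hypotheses (b_complete : seminorm_complete b S)
  (b_bounded : forall u, S u -> seminrm b u <= c * `‖u‖).
Hypotheses (cT_ge0 : 0 <= cT) (T_bounded : forall u, `‖T u‖ <= cT * `‖u‖)
  (T_compact : precompact [set T u | u in [set u | S u /\ `‖u‖ <= 1]]).
Hypotheses (K_sub : K `<=` S)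
  (K_kernel : forall v, (forall w, b v w = 0) <-> K v).
Variables (l : nat) (eK : 'I_l -> V) (KE : K = lin_span eK).

Let hT : subspace (@setT V). Proof. by []. Qed.
Let bS_ge0 : psd_on S b. Proof. by move=> u _; exact: b_ge0. Qed.

Lemma seminrm_kernel u : seminrm b u = 0 -> K u.
Proof. by move=> u0; apply/K_kernel => w; exact: (form_null hT b_ge0). Qed.

Lemma kernel_form k w : K k -> b k w = 0.
Proof. by move=> /K_kernel. Qed.

Lemma kernel_formr k w : K k -> b w k = 0.
Proof. by move=> Kk; rewrite form_sym kernel_form// conjC0. Qed.

Variables (n : nat) (e : 'I_n -> V).

(** When the [e j] are eigenvectors whose span contains [K], this subspace is
    orthogonal to that span both for [b] and for [⟪T _, T _⟫]. *)
Definition complement : set V := [set u | [/\ S u,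
  forall k, K k -> ⟪T u, T k⟫ = 0 & forall j, b u (e j) = 0]].

Lemma complement_subspace : subspace complement.
Proof.
split.
  split; [by case: hS | by move=> k _; rewrite linear0 linear0l | move=> j; exact: linear0l].
move=> a u v [Su Ku eu] [Sv Kv ev]; split; first by case: hS => _; exact.
  move=> k Kk; rewrite linearP linearDl linearZl_LR /=.
  by rewrite -/(⟪T v, T k⟫) -/(⟪T u, T k⟫) Ku// Kv// mulr0 addr0.
by move=> j; rewrite linearDl linearZl_LR /= eu ev mulr0 addr0.
Qed.

Lemma complement_bound : exists2 C : R, 0 < C & forall u, complement u ->
  exists u', [/\ S u', K (u - u') & `‖u'‖ <= C * seminrm b u].
Proof.
have [C C0 hC] := bounded_representative hS Scl bS_ge0 b_complete b_bounded.
exists C => // u [Su _ _]; have [u' [Su' uu' hu']] := hC u Su.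
by exists u'; split=> //; exact: seminrm_kernel.
Qed.

(** The image of [complement] is orthogonal to the image of [K], so among the
    representatives of a class modulo [K] the one in [complement] has the smallest
    image.  Bounds on [T] and compactness carry over from the representatives of
    [complement_bound]. *)
Lemma complement_nrm_le u u' : complement u -> K (u - u') -> `‖T u‖ <= `‖T u'‖.
Proof.
move=> [_ Ku _] /Ku h; have -> : T u' = T u - T (u - u').
  by rewrite linearB opprB addrC subrK.
exact: nrm_le_orth.
Qed.

Lemma kernel_projection x : S x -> exists k, K k /\
  forall k', K k' -> ⟪T (x - k), T k'⟫ = 0.
Proof.
move=> Sx.
have psd : psd_on setT (pencil b T 0 1).
  by move=> u _; rewrite Re_pencil mul0r add0r mul1r sqr_ge0.
have [d hd] := orthogonal_residual hT psd (e := eK) (x := x) (fun=> I) I.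
exists (\sum_i d i *: eK i); split; first by rewrite KE; exists d.
move=> k'; rewrite KE => -[d' ->].
have <- : pencil b T 0 1 (x - \sum_i d i *: eK i) (\sum_i d' i *: eK i) = 
  ⟪T (x - \sum_i d i *: eK i), T (\sum_i d' i *: eK i)⟫.
  by rewrite /pencil rmorph0 mul0r add0r rmorph1 mul1r.
by rewrite form_sumr big1// => i _; rewrite hd mulr0.
Qed.

(** For a sequence maximizing the Rayleigh quotient, with supremum [mu], the
    semidefinite form [mu b - ⟪T _, T _⟫] tends to 0; together with the convergence
    of the images under the compact [T], this makes the sequence Cauchy. *)
Theorem rayleigh_maximizer lam u0 : 0 <= lam -> complement u0 ->
  lam * complex.Re (b u0 u0) < `‖T u0‖ ^+ 2 ->
  exists mu v, [/\ lam < mu, complement v, v <> 0 &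
    forall x, complement x -> ⟪T v, T x⟫ = mu%:C * b v x].
Proof.
move=> lam0 Eu0 hu0.
have [C C0 hC] := complement_bound.
have q_ge0 u : 0 <= complex.Re (b u u) by exact: b_ge0.
have hE := complement_subspace.
have TC u : complement u -> `‖T u‖ <= cT * C * seminrm b u.
  move=> Eu; have [u' [_ uu' hu']] := hC u Eu.
  apply: (le_trans (complement_nrm_le Eu uu')); apply: (le_trans (T_bounded _)).
  by rewrite -mulrA ler_wpM2l.
have normalize u : complement u -> 0 < complex.Re (b u u) ->
    exists2 u1, complement u1 /\ complex.Re (b u1 u1) = 1 &
      `‖T u1‖ ^+ 2 = `‖T u‖ ^+ 2 / complex.Re (b u u).
  move=> Eu u0'; have s0 : 0 < seminrm b u by rewrite sqrtr_gt0.
  have sE := seminrm_sqr b_ge0 (I : setT u).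
  exists ((seminrm b u)^-1%:C *: u).
    split; first exact: subspaceZ.
    rewrite qformZ nrm_real gtr0_norm ?invr_gt0// -sE exprVn.
    by rewrite mulVf// expf_neq0// lt0r_neq0.
  by rewrite linearZ_LR nrmZ exprMn nrm_real gtr0_norm ?invr_gt0// -sE exprVn mulrC.
pose A := [set r : R | exists u, [/\ complement u, complex.Re (b u u) = 1 & r = `‖T u‖ ^+ 2]].
have q0 : 0 < complex.Re (b u0 u0).
  rewrite lt_neqAle q_ge0 andbT; apply/negP => /eqP z.
  have := TC _ Eu0; rewrite /seminrm -z sqrtr0 mulr0 => h.
  have {}h : `‖T u0‖ = 0 by apply/eqP; rewrite eq_le h nrm_ge0.
  by move: hu0; rewrite -z h expr0n mulr0 ltxx.
have Aub : ubound A ((cT * C) ^+ 2).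
  move=> _ [u [Eu u1 ->]]; rewrite ler_sqr ?nnegrE ?nrm_ge0//; last first.
    by rewrite mulr_ge0// ltW.
  by apply: (le_trans (TC _ Eu)); rewrite /seminrm u1 sqrtr1 mulr1.
have [u1 [Eu1 hu1] hTu1] := normalize _ Eu0 q0.
have supA : has_sup A.
  by split; [exists (`‖T u1‖ ^+ 2), u1 | exists ((cT * C) ^+ 2)].
set mu := sup A.
have lam_mu : lam < mu.
  apply: lt_le_trans (ub_le_sup supA.2 _); last by exists u1; split.
  by rewrite hTu1 ltr_pdivlMr.
have mu0 : 0 < mu by exact: le_lt_trans lam_mu.
have rayleigh u : complement u -> `‖T u‖ ^+ 2 <= mu * complex.Re (b u u).
  move=> Eu; have [z|zN0] := eqVneq (complex.Re (b u u)) 0.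
    have := TC _ Eu; rewrite /seminrm z sqrtr0 !mulr0 => h.
    have -> : `‖T u‖ = 0 by apply/eqP; rewrite eq_le h nrm_ge0.
    by rewrite expr0n.
  have z0 : 0 < complex.Re (b u u) by rewrite lt_neqAle eq_sym zN0 q_ge0.
  have [w [Ew hw] hTw] := normalize _ Eu z0.
  by rewrite -ler_pdivrMr// -hTw; apply: (ub_le_sup supA.2); exists w.
pose a := pencil b T mu (-1).
have aE u : complex.Re (a u u) = mu * complex.Re (b u u) - `‖T u‖ ^+ 2.
  by rewrite Re_pencil mulN1r.
have a_ge0 : psd_on complement a.
  by move=> u Eu; rewrite aE subr_ge0; exact: rayleigh.
have a_par u v : complement u -> complement v ->
    complex.Re (a (u - v) (u - v)) <= 2 * complex.Re (a u u) + 2 * complex.Re (a v v).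
  move=> Eu Ev; have := a_ge0 _ (subspaceD hE Eu Ev).
  by rewrite qformD qformB; lra.
have half_gt0 k : 0 < 2^-1 ^+ k :> R by rewrite exprn_gt0// invr_gt0.
(* Compactness of [T] bears on the representatives [u' k], bounded in norm, of
   the terms [u k], which are only bounded for [b]. *)
have /choice [u hu] : forall k : nat, exists w, [/\ complement w,
    complex.Re (b w w) = 1 & complex.Re (a w w) < 2^-1 ^+ k].
  move=> k; have [_ [w [Ew hw ->]] hlt] := sup_adherent (half_gt0 k) supA.
  by exists w; split=> //; rewrite aE hw mulr1; move: hlt; rewrite -/mu; lra.
have /choice [u' hu'] : forall k : nat, exists w,
    [/\ S w, K (u k - w) & `‖w‖ <= C].
  move=> k; have [Eu hq _] := hu k; have [w [Sw Kw hw]] := hC _ Eu.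
  by exists w; split=> //; move: hw; rewrite /seminrm hq sqrtr1 mulr1.
have [z hz] : exists z, forall eps : R, 0 < eps -> forall j,
    exists2 k, (j <= k)%N & `‖C^-1%:C *: T (u' k) - z‖ < eps.
  apply: (precompact_cluster T_compact) => k; have [Su' _ nu'] := hu' k.
  exists (C^-1%:C *: u' k); last by rewrite linearZ_LR.
  split; first exact: subspaceZ.
  by rewrite nrmZ nrm_real gtr0_norm ?invr_gt0// mulrC ler_pdivrMr// mul1r.
have /choice [s hs] : forall j : nat, exists k : nat, (j <= k)%N /\
    `‖C^-1%:C *: T (u' k) - z‖ < 2^-1 ^+ j.
  by move=> j; have [k jk hk] := hz _ (half_gt0 j) j; exists k.
pose w j := u (s j).
have Ew j : complement (w j) by case: (hu (s j)).
have Sw j : S (w j) by case: (Ew j).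
have mono N j : (N <= j)%N -> 2^-1 ^+ j <= 2^-1 ^+ N :> R.
  by move=> Nj; rewrite ler_wiXn2l ?invr_ge0 ?invf_le1 ?ler1n.
have aw N j : (N <= j)%N -> complex.Re (a (w j) (w j)) <= 2^-1 ^+ N.
  move=> Nj; have [_ _ /ltW h] := hu (s j); apply: (le_trans h); apply: mono.
  by apply: (leq_trans Nj); case: (hs j).
have Tw N j k : (N <= j)%N -> (N <= k)%N ->
    `‖T (w j - w k)‖ <= 2 * C * 2^-1 ^+ N.
  move=> Nj Nk; have [_ Kj _] := hu' (s j); have [_ Kk _] := hu' (s k).
  have Kjk : K ((w j - w k) - (u' (s j) - u' (s k))).
    rewrite opprD addrACA -opprD; move: Kj Kk; rewrite KE.
    exact: subspaceB (subspace_span eK).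
  apply: (le_trans (complement_nrm_le (subspaceB hE (Ew j) (Ew k)) Kjk)).
  have -> : T (u' (s j) - u' (s k)) = C%:C *:
      ((C^-1%:C *: T (u' (s j)) - z) - (C^-1%:C *: T (u' (s k)) - z)).
    rewrite opprB addrA subrK scalerBr !scalerA -rmorphM /= divff ?lt0r_neq0//.
    by rewrite !scale1r linearB.
  have -> : 2 * C * 2^-1 ^+ N = C * (2 * 2^-1 ^+ N) by ring.
  rewrite nrmZ nrm_real gtr0_norm//; apply: ler_wpM2l; first exact: ltW.
  apply: (le_trans (nrmD _ _)); rewrite nrmN.
  have [_ h1] := hs j; have [_ h2] := hs k.
  by have := mono _ _ Nj; have := mono _ _ Nk; move: h1 h2; lra.
have wcauchy eps : 0 < eps -> exists N, forall j k : nat, (N <= j)%N -> (N <= k)%N ->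
    seminrm b (w j - w k) < eps.
  move=> eps0; have e0 : 0 < mu * eps ^+ 2 by rewrite mulr_gt0// exprn_gt0.
  have [N hN] := geometric_lt (4 + 4 * C ^+ 2) e0; exists N => j k Nj Nk.
  rewrite -ltr_sqr ?nnegrE ?seminrm_ge0 ?ltW// (seminrm_sqr b_ge0)//.
  rewrite -(ltr_pM2l mu0); apply: le_lt_trans hN.
  have := a_par _ _ (Ew j) (Ew k); rewrite [X in X <= _]aE.
  have := Tw _ _ _ Nj Nk; have := aw _ _ Nj; have := aw _ _ Nk.
  set q := 2^-1 ^+ N => h1 h2 h3 h4.
  have q1 : q <= 1 by rewrite exprn_ile1 ?invr_ge0 ?invf_le1 ?ler1n.
  have h5 : `‖T (w j - w k)‖ ^+ 2 <= 4 * C ^+ 2 * q.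
    have q0' : 0 <= q by exact: ltW (half_gt0 N).
    have Cq : 0 <= 2 * C * q by apply: mulr_ge0 => //; apply: mulr_ge0 => //; exact: ltW C0.
    apply: (@le_trans _ _ ((2 * C * q) ^+ 2)); first by rewrite ler_sqr ?nnegrE ?nrm_ge0.
    have -> : (2 * C * q) ^+ 2 = 4 * C ^+ 2 * q * q by ring.
    by rewrite -[leRHS]mulr1; apply: ler_wpM2l => //; apply: mulr_ge0 => //; apply: mulr_ge0 => //; exact: sqr_ge0.
  by move: h1 h2 h4 h5; lra.
(* Completeness provides a limit modulo [K]; [v] is its representative in
   [complement]. *)
have [x Sx hx] := b_complete Sw wcauchy.
have [k [Kk hk]] := kernel_projection Sx.
pose v := x - k.
have wv eps : 0 < eps -> exists N, forall j, (N <= j)%N ->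
    seminrm b (w j - v) < eps.
  move=> /hx [N hN]; exists N => j /hN h; apply: le_lt_trans h.
  have -> : w j - v = (w j - x) + k by rewrite /v opprB addrCA addrC.
  apply: (le_trans (seminrmD hT b_ge0 (I : setT _) (I : setT _))).
  by rewrite [seminrm b k]/seminrm kernel_form//= sqrtr0 addr0.
have Ev : complement v.
  split=> //; first by apply: subspaceB => //; exact: K_sub.
  move=> j; apply/eqP; rewrite -nrm_eq0 eq_le nrm_ge0 andbT.
  apply/ler_addgt0Pr => eps eps0; rewrite add0r.
  have c0 : 0 < seminrm b (e j) + 1 by rewrite ltr_wpDl ?seminrm_ge0.
  have [N /(_ N (leqnn _)) hN] := wv _ (divr_gt0 eps0 c0).
  have [_ _ /(_ j) wj] := Ew N.
  have -> : b v (e j) = - b (w N - v) (e j) by rewrite [in RHS]linearBl /= wj sub0r opprK.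
  rewrite nrmN; apply: (le_trans (cauchy_schwarz_seminrm hT b_ge0 (I : setT _) (I : setT _))).
  move: hN; rewrite ltr_pdivlMr// => hN.
  have := seminrm_ge0 b (w N - v); move: hN; lra.
have close eps : 0 < eps -> exists j, [/\ complex.Re (b (w j - v) (w j - v)) < eps &
    complex.Re (a (w j) (w j)) < eps].
  move=> eps0; have [N hN] := geometric_lt 1 eps0.
  have se0 : 0 < Num.sqrt eps by rewrite sqrtr_gt0.
  have [N' hN'] := wv _ se0; exists (maxn N N'); split.
    have := hN' _ (leq_maxr N N').
    by rewrite /seminrm ltr_sqrt.
  by apply: (le_lt_trans (aw _ _ (leq_maxl N N'))); rewrite mul1r in hN.
exists mu, v; split=> //.
  move=> v0; have [j []] := close (1 / 2) ltac:(by rewrite divr_gt0).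
  by rewrite v0 subr0; have [_ -> _] := hu (s j); lra.
have av : complex.Re (a v v) = 0.
  apply/eqP; rewrite eq_le a_ge0// andbT; apply/ler_addgt0Pr => eps eps0.
  rewrite add0r; have m1 : 0 < 4 * mu + 4 by lra.
  have [j [h1 h2]] := close _ (divr_gt0 eps0 m1).
  have := a_par _ _ (Ew j) (subspaceB hE (Ew j) Ev).
  have -> : w j - (w j - v) = v by rewrite opprB addrC subrK.
  rewrite [complex.Re (a (w j - v) _)]aE => h3; have := sqr_ge0 (`‖T (w j - v)‖).
  move: h1 h2; rewrite !ltr_pdivlMr// => h1 h2 h4.
  set A1 := complex.Re (b _ _) in h1 h3; set A2 := complex.Re (a (w j) _) in h2 h3.
  have A1' : 0 <= A1 by exact: q_ge0.
  have A2' : 0 <= A2 by exact: a_ge0.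
  have : 0 <= A2 * mu by rewrite mulr_ge0// ltW.
  by move: h1 h2 h3 h4 A1' A2'; lra.
move=> y Ey; have : a v y = 0.
  by apply: (form_null hE a_ge0) => //; rewrite /seminrm av sqrtr0.
by rewrite /a /pencil rmorphN1 mulN1r => /eqP; rewrite subr_eq0 => /eqP.
Qed.

End Spectral.

(** * Eigenpairs and the n-width *)

Lemma nontrivial_solution (F : fieldType) m n (A : 'I_n -> 'I_m -> F) :
  (m < n)%N -> exists x : 'I_n -> F, (exists j, x j != 0) /\
    forall i, \sum_j x j * A j i = 0.
Proof.
move=> mn; pose M : 'M[F]_(n, m) := \matrix_(j, i) A j i.
have : kermx M != 0.
  rewrite -mxrank_eq0 mxrank_ker subn_eq0 -ltnNge.
  exact: leq_ltn_trans (rank_leq_col M) mn.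
move=> /rowV0Pn [x xM x0]; exists (fun j => x 0 j); split.
  apply: contrapT => h; move/eqP: x0; apply; apply/rowP => j; rewrite mxE.
  by apply/eqP; apply: contrapT => /negP hj; apply: h; exists j.
move=> i; move/sub_kermxP: xM => /rowP /(_ i); rewrite !mxE => h; apply: etrans h.
by apply: eq_bigr => j _; rewrite mxE.
Qed.

Section Eigen.
Variables (R : realType) (V : completeNormedModType R[i]) (W : hilbertType R).
Variables (T : {linear V -> W}) (b : {hermitian_sym V for conjC}).
Variables (S K : set V) (c cT : R).
Hypotheses (hS : subspace S) (Scl : closed S) (b_ge0 : psd_on setT b).
Hypotheses (b_complete : seminorm_complete b S)
  (b_bounded : forall u, S u -> seminrm b u <= c * `‖u‖).
Hypotheses (cT_ge0 : 0 <= cT) (T_bounded : forall u, `‖T u‖ <= cT * `‖u‖)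
  (T_compact : precompact [set T u | u in [set u | S u /\ `‖u‖ <= 1]]).
Hypotheses (K_sub : K `<=` S)
  (K_kernel : forall v, (forall w, b v w = 0) <-> K v)
  (K_inj : forall u, K u -> T u = 0 -> u = 0).
Variables (l : nat) (eK : 'I_l -> V) (KE : K = lin_span eK).

Definition eigen (lam : \bar R) (v : V) := [/\ S v, v <> 0 &
  match lam with
  | r%:E => forall w, S w -> ⟪T v, T w⟫ = r%:C * b v w
  | +oo%E => K v
  | -oo%E => False
  end].

Variables (n : nat) (lam : 'I_n -> \bar R) (e : 'I_n -> V).
Hypotheses (ln : (l < n)%N) (eig : forall j, eigen (lam j) (e j))
  (lam_mono : forall j k : 'I_n, (j <= k)%N -> (lam k <= lam j)%E)
  (e_indep : lin_indep e)
  (e_exhaust : forall (j : 'I_n) mu v, eigen mu v -> (lam j < mu)%E ->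
     exists d : 'I_n -> R[i], v = \sum_(k < n | (k < j)%N) d k *: e k).

Let hT : subspace (@setT V). Proof. by []. Qed.
Let q_ge0 u : 0 <= complex.Re (b u u). Proof. exact: b_ge0. Qed.
Let E := complement T b S K e.
Let hE : subspace E. Proof. exact: complement_subspace. Qed.
Let Se j : S (e j). Proof. by case: (eig j). Qed.

(** [K] is the kernel of [b] and [T] is injective on it. *)
Lemma null_eq0 u : (forall k, K k -> ⟪T u, T k⟫ = 0) -> seminrm b u = 0 -> u = 0.
Proof.
move=> uK u0; have Ku := seminrm_kernel b_ge0 K_kernel u0.
by apply: K_inj => //; apply/eqP; rewrite -nrm_eq0 -sqrf_eq0 -hdot_nrm uK.
Qed.

Lemma real_eigen_form r u v : eigen r%:E u -> S v ->
  ⟪T v, T u⟫ = r%:C * b v u.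
Proof.
by move=> [Su _ h] Sv; rewrite hdot_sym h// rmorphM /= conjC_real -form_sym.
Qed.

Lemma real_eigen_kernel r u k : eigen r%:E u -> K k -> ⟪T u, T k⟫ = 0.
Proof.
move=> [Su _ h] Kk; rewrite h; last exact: K_sub.
by rewrite (kernel_formr K_kernel)// mulr0.
Qed.

Lemma eigen_ge0 r u : eigen r%:E u -> 0 <= r.
Proof.
move=> hu; have [Su u0 h] := hu.
have q0 : 0 < complex.Re (b u u).
  rewrite lt_neqAle q_ge0 andbT; apply/negP => /eqP z; apply: u0.
  apply: null_eq0; last by rewrite /seminrm -z sqrtr0.
  by move=> k; exact: real_eigen_kernel hu.
have := congr1 (@complex.Re R) (h u Su); rewrite hdot_nrm ReZ => hn.
by rewrite -(pmulr_lge0 _ q0) -hn sqr_ge0.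
Qed.

(** The last eigenvalue is finite: more than [l] independent vectors do not fit
    into [K]. *)
Lemma last_eigenvalue : exists2 r : R, 0 <= r & exists2 j0 : 'I_n, lam j0 = r%:E &
  forall j : 'I_n, (r%:E <= lam j)%E.
Proof.
have n0 : (n.-1 < n)%N by rewrite ltn_predL (leq_ltn_trans _ ln).
pose j0 := Ordinal n0.
have j0P j : (lam j0 <= lam j)%E.
  by apply: lam_mono; rewrite /= -ltnS (ltn_predK ln).
case lamE : (lam j0) => [r| |].
- exists r; first by apply: (@eigen_ge0 _ (e j0)); rewrite -lamE.
  by exists j0 => // j; rewrite -lamE.
- have eK' j : K (e j).
    have := eig j; have := j0P j; rewrite lamE leye_eq => /eqP ->.
    by case.
  have /choice [A hA] : forall j, exists d : 'I_l -> R[i], e j = \sum_i d i *: eK i.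
    by move=> j; have := eK' j; rewrite KE.
  have [x [[j xj] hx]] := nontrivial_solution A ln.
  have : \sum_j x j *: e j = 0.
    under eq_bigr do rewrite hA scaler_sumr.
    rewrite exchange_big big1//= => i _.
    under eq_bigr do rewrite scalerA.
    by rewrite -scaler_suml hx scale0r.
  by move/e_indep/(_ j)/eqP; rewrite (negbTE xj).
- by have [_ _] := eig j0; rewrite lamE.
Qed.

(** The last eigenvalue being finite, the eigenspace [K] of the eigenvalue [+oo] is
    exhausted before it. *)
Lemma span_kernel k : K k -> lin_span e k.
Proof.
move=> Kk; have [->|k0] := eqVneq k 0; first by case: (subspace_span e).
have [r _ [j0 j0E _]] := last_eigenvalue.
have [||d ->] := e_exhaust (j := j0) (mu := +oo%E) (v := k).
- by split=> //; [exact: K_sub|exact/eqP].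
- by rewrite j0E ltry.
apply: subspace_sum; first exact: subspace_span.
move=> i _; apply: subspaceZ; first exact: subspace_span.
exists (fun j => (j == i)%:R); rewrite (bigD1 i)//= eqxx scale1r big1 ?addr0//.
by move=> j /negbTE ->; rewrite scale0r.
Qed.

(** One orthogonal projection, for the form [b + ⟪T _, T _⟫], makes the residual
    orthogonal in both senses: on an eigenvector of finite eigenvalue [r] this form
    is [(1 + r) b], and on [K] it is [⟪T _, T _⟫]. *)
Lemma complement_residual w : S w ->
  exists d : 'I_n -> R[i], E (w - \sum_j d j *: e j).
Proof.
move=> Sw.
have psd : psd_on setT (pencil b T 1 1).
  by move=> u _; rewrite Re_pencil !mul1r addr_ge0// ?sqr_ge0.
have [d hd] := orthogonal_residual hT psd (e := e) (x := w) (fun=> I) I.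
exists d; set w' := w - _ in hd *.
have Sw' : S w' by apply: subspaceB => //; exact: subspace_comb.
have pencilE v : pencil b T 1 1 w' v = b w' v + ⟪T w', T v⟫.
  by rewrite /pencil rmorph1 !mul1r.
split=> //.
  move=> k Kk; have [a kE] := span_kernel Kk.
  have := pencilE k; rewrite (kernel_formr K_kernel)// add0r => <-.
  by rewrite kE form_sumr big1// => j _; rewrite hd mulr0.
move=> j; have : pencil b T 1 1 w' (e j) = 0 := hd j.
rewrite pencilE; move: (eig j).
case: (lam j) => [r hr|[_ _ /(kernel_formr K_kernel) //]|[]//].
rewrite (real_eigen_form hr)// -{1}[b w' (e j)]mul1r -mulrDl.
move/eqP; rewrite mulf_eq0 => /orP[/eqP h|/eqP//].
by exfalso; move: (congr1 (@complex.Re R) h) => {h}; have := eigen_ge0 hr; rewrite ReD /=; lra.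
Qed.

Lemma complement_T_orth u j : E u -> ⟪T u, T (e j)⟫ = 0.
Proof.
move=> [Su uK ue]; have := eig j.
case: (lam j) => [r hr|[_ _ /uK]//|[]//].
by rewrite (real_eigen_form hr)// ue mulr0.
Qed.

Lemma complement_form_comb u (d : 'I_n -> R[i]) : E u ->
  b u (\sum_j d j *: e j) = 0.
Proof. by move=> [_ _ ue]; rewrite form_sumr big1// => j _; rewrite ue mulr0. Qed.

Lemma complement_T_comb u (d : 'I_n -> R[i]) : E u ->
  ⟪T u, T (\sum_j d j *: e j)⟫ = 0.
Proof.
move=> Eu; rewrite linear_sum.
under eq_bigr do rewrite linearZ_LR.
by rewrite hdot_sumr big1// => j _; rewrite complement_T_orth// mulr0.
Qed.

(** A larger Rayleigh quotient would produce an eigenvalue above the last one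
    listed, hence an eigenvector in the span of the [e j], to which it is
    orthogonal. *)
Lemma complement_rayleigh_le r j0 u : 0 <= r -> lam j0 = r%:E -> E u ->
  `‖T u‖ ^+ 2 <= r * complex.Re (b u u).
Proof.
move=> r0 j0E Eu; rewrite leNgt; apply/negP => hu.
have [mu [v [rmu Ev v0 hv]]] := rayleigh_maximizer hS Scl b_ge0 b_complete
  b_bounded cT_ge0 T_bounded T_compact K_sub K_kernel KE r0 Eu hu.
have [Sv Kv ev] := Ev; apply: (v0).
have hmu : eigen mu%:E v.
  split=> // w Sw; have [d Ew] := complement_residual Sw.
  rewrite -[w](subrK (\sum_j d j *: e j)) linearD hdotDr linearDr /=.
  by rewrite (complement_T_comb _ Ev) (complement_form_comb _ Ev) !addr0 hv.
have [|d vE] := e_exhaust (j := j0) hmu; first by rewrite j0E lte_fin.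
apply: null_eq0 => //; rewrite /seminrm {2}vE linear_sumr big1 /= ?sqrtr0//.
by move=> k _; rewrite linearZr_LR /= ev mulr0.
Qed.

(** Eigenvectors of distinct finite eigenvalues are orthogonal for [b], so for
    finite eigenvalues the Gram matrix of [⟪T _, T _⟫ - r b] has the entries
    [sqrt (lam i - r) * sqrt (lam j - r) * b (e i) (e j)].  Hence the difference of
    the two sides is the square of the seminorm of the reweighted vector [g],
    plus the square of the norm of the image of the part [k] of [f] in [K]. *)
Lemma span_rayleigh_ge r f : (forall j, (r%:E <= lam j)%E) -> lin_span e f ->
  r * complex.Re (b f f) <= `‖T f‖ ^+ 2.
Proof.
move=> r_le [d fE].
pose kap j : R := if lam j == +oo%E then 1 else 0.
pose sig j : R := if lam j is x%:E then Num.sqrt (x - r) else 0.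
pose k := \sum_j (d j * (kap j)%:C) *: e j.
pose g := \sum_j (d j * (sig j)%:C) *: e j.
have term i j : pencil b T (- r) 1 (e i) (e j) =
    (kap i)%:C * (kap j)%:C * pencil b T 0 1 (e i) (e j) +
    (sig i)%:C * (sig j)%:C * b (e i) (e j).
  rewrite /pencil rmorph0 rmorph1 mul0r add0r !mul1r rmorphN mulNr.
  have hi := eig i; have hj := eig j; have li := r_le i; have lj := r_le j.
  rewrite /kap /sig; move: hi hj li lj.
  case: (lam i) => [x|[_ _ Ki]|[]//]; last first.
    rewrite (kernel_form K_kernel)// !mulr0 oppr0 add0r addr0 eqxx.
    case: (lam j) => [y hj|_|[]//] _ _; last by rewrite eqxx !mul1r.
    by rewrite (real_eigen_form hj)// (kernel_form K_kernel)// !mulr0.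
  move=> hi; case: (lam j) => [y hj|hj|[]//].
    rewrite !lee_fin => xr yr /=; rewrite rmorph0 !mul0r add0r.
    have h1 : ⟪T (e i), T (e j)⟫ = x%:C * b (e i) (e j) by case: hi => _ _; apply.
    have h2 : ⟪T (e i), T (e j)⟫ = y%:C * b (e i) (e j).
      by rewrite (real_eigen_form hj).
    have [b0|bN0] := eqVneq (b (e i) (e j)) 0; first by rewrite h1 b0 !mulr0 oppr0 addr0.
    have xy : x = y.
      by apply: complexI; apply: (mulIf bN0); rewrite -h1 -h2.
    rewrite h1 -xy -rmorphM /= -expr2 sqr_sqrtr ?subr_ge0// rmorphB mulrBl addrC.
    by [].
  move=> _ _; have [_ _ Kj] := hj; rewrite (real_eigen_kernel hi)//.
  by rewrite (kernel_formr K_kernel)// !mulr0 oppr0 !addr0.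
have key : pencil b T (- r) 1 f f = pencil b T 0 1 k k + b g g.
  rewrite fE /k /g !form_suml -big_split; apply: eq_bigr => i _ /=.
  rewrite !form_sumr !mulr_sumr -big_split; apply: eq_bigr => j _ /=.
  by rewrite term !rmorphM /= !conjC_real; ring.
have := congr1 (@complex.Re R) key; rewrite [RHS]ReD !Re_pencil mul0r add0r !mul1r.
by have := q_ge0 g; have := sqr_ge0 `‖T k‖; lra.
Qed.

(** A dimension count: [n + 1] unknowns against the [l] equations of
    orthogonality to the image of [K] and the [m] equations of orthogonality to
    the approximating space. *)
Lemma span_width_witness m (q : 'I_m -> W) w : (l + m <= n)%N -> E w -> T w <> 0 ->
  exists u, [/\ S u, forall k, K k -> ⟪T u, T k⟫ = 0, 0 < seminrm b u,
    forall v, lin_span q v -> ⟪T u, v⟫ = 0 &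
    `‖T w‖ / seminrm b w <= `‖T u‖ / seminrm b u].
Proof.
move=> lmn Ew Tw0.
pose e' (j : 'I_n.+1) := if unlift ord0 j is Some i then e i else w.
pose A (j : 'I_n.+1) (i : 'I_(l + m)) := match fintype.split i with
  | inl i => ⟪T (e' j), T (eK i)⟫ | inr i => ⟪T (e' j), q i⟫ end.
have [x [[j xj] hx]] := nontrivial_solution A lmn.
pose d i := x (lift ord0 i); pose f := \sum_i d i *: e i.
pose u := x ord0 *: w + f.
have uE : u = \sum_j x j *: e' j.
  rewrite big_ord_recl /e' unlift_none; congr (_ + _).
  by apply: eq_bigr => i _; rewrite liftK.
have Sw : S w by case: Ew.
have Su : S u.
  by apply: subspaceD => //; [exact: subspaceZ|exact: subspace_comb].
have TuE y : ⟪T u, y⟫ = \sum_j x j * ⟪T (e' j), y⟫.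
  rewrite uE linear_sum; under eq_bigr do rewrite linearZ_LR.
  by rewrite hdot_suml.
have uK k : K k -> ⟪T u, T k⟫ = 0.
  rewrite KE => -[a ->]; rewrite linear_sum; under eq_bigr do rewrite linearZ_LR.
  rewrite hdot_sumr big1// => i _.
  have := hx (unsplit (inl i)); rewrite /A unsplitK -/(TuE _) => h.
  by rewrite TuE h mulr0.
have uq v : lin_span q v -> ⟪T u, v⟫ = 0.
  move=> [a ->]; rewrite hdot_sumr big1// => i _.
  have := hx (unsplit (inr i)); rewrite /A unsplitK => h.
  by rewrite TuE h mulr0.
have fw : ⟪T (x ord0 *: w), T f⟫ = 0.
  by apply: complement_T_comb; exact: subspaceZ.
have bfw : b (x ord0 *: w) f = 0.
  by apply: complement_form_comb; exact: subspaceZ.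
have Tu2 : `‖T u‖ ^+ 2 = `‖x ord0‖ ^+ 2 * `‖T w‖ ^+ 2 + `‖T f‖ ^+ 2.
  by rewrite /u linearD nrmD_orth// linearZ_LR nrmZ exprMn.
have bu2 : complex.Re (b u u) =
    `‖x ord0‖ ^+ 2 * complex.Re (b w w) + complex.Re (b f f).
  by rewrite /u qformD_orth// qformZ.
have Tw : 0 < `‖T w‖ by rewrite lt_neqAle nrm_ge0 eq_sym nrm_eq0 andbT; exact/eqP.
have [r r0 [j0 j0E r_le]] := last_eigenvalue.
have wr := complement_rayleigh_le r0 j0E Ew.
have fr : r * complex.Re (b f f) <= `‖T f‖ ^+ 2 .
  by apply: span_rayleigh_ge r_le _; exists d.
have bw : 0 < complex.Re (b w w).
  rewrite lt_neqAle q_ge0 andbT; apply/negP => /eqP z.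
  by have := exprn_gt0 2 Tw; move: wr; rewrite -z mulr0; lra.
have bu : 0 < complex.Re (b u u).
  rewrite lt_neqAle q_ge0 andbT; apply/negP => /eqP z.
  have u0 : u = 0 by apply: null_eq0 => //; rewrite /seminrm -z sqrtr0.
  have : `‖x ord0‖ ^+ 2 * complex.Re (b w w) <= 0.
    by rewrite [leRHS]z bu2 lerDl.
  rewrite pmulr_lle0// => x0; have {}x0 : x ord0 = 0.
    by apply/eqP; rewrite -nrm_eq0 -sqrf_eq0 eq_le x0 sqr_ge0.
  have f0 : f = 0 by move: u0; rewrite /u x0 scale0r add0r.
  have d0 := e_indep f0; move/eqP: xj; apply.
  by case: (unliftP ord0 j) => [i ->|->//]; exact: d0.
have su : 0 < seminrm b u by rewrite sqrtr_gt0.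
have sw : 0 < seminrm b w by rewrite sqrtr_gt0.
exists u; split=> //.
rewrite ler_pdivrMr// mulrAC ler_pdivlMr//.
rewrite -ler_sqr ?nnegrE ?mulr_ge0 ?nrm_ge0 ?seminrm_ge0// !exprMn.
rewrite !(seminrm_sqr b_ge0)// Tu2 bu2 mulrDr mulrDl lerD//.
  by rewrite mulrCA mulrA.
have h1 : `‖T w‖ ^+ 2 * complex.Re (b f f) <=
    r * complex.Re (b w w) * complex.Re (b f f) by rewrite ler_wpM2r.
apply: (le_trans h1); rewrite mulrAC ler_wpM2r//.
Qed.

Lemma seminrm_residual w (d : 'I_n -> R[i]) :
  E (w - \sum_j d j *: e j) -> seminrm b (w - \sum_j d j *: e j) <= seminrm b w.
Proof.
set f := \sum_j _; move=> Ew; rewrite ler_wsqrtr//.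
by rewrite -[in leRHS](subrK f w) (qformD_orth (complement_form_comb d Ew)) lerDl.
Qed.

End Eigen.

(** * Local approximation *)

Section Local.
Variables (R : realType) (d : nat) (Om : lipschitzDomain R d).
Variables (X : framework Om).

Lemma HB_subspace (D : subdomain Om) : subspace (@HB _ _ _ X D).
Proof.
split=> [v|a u u' hu hu' v]; first exact: linear0l.
by rewrite linearDl linearZl_LR /= hu hu' mulr0 addr0.
Qed.

Lemma HB_closed (D : subdomain Om) : closed (@HB _ _ _ X D).
Proof.
move=> u clu v; have [c hc] := form_bounded X D.
apply/eqP; rewrite -nrm_eq0 eq_le nrm_ge0 andbT.
apply/ler_addgt0Pr => e e0; rewrite add0r.
set C := `|c| * `‖inc0 X D v‖ + 1.
have C0 : 0 < C by rewrite ltr_wpDl// mulr_ge0// nrm_ge0.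
have eC : 0 < e / C by rewrite divr_gt0.
have [u' [hu']] := clu (ball u (e / C)%:C) (nbhsx_ballx _ _ (etrans (ltcR 0 _) eC)).
rewrite -ball_normE /= normE ltcR => huu'.
have -> : Defs.form X D u (inc0 X D v) = Defs.form X D (u - u') (inc0 X D v).
  by rewrite linearBl /= [Z in _ - Z]hu' subr0.
apply: (le_trans (hc _ _)).
apply: (@le_trans _ _ (`‖u - u'‖ * C)); last first.
  by rewrite -ler_pdivlMr//; exact: ltW.
rewrite mulrAC [leLHS]mulrC ler_wpM2l ?nrm_ge0//.
apply: (@le_trans _ _ (`|c| * `‖inc0 X D v‖)); last by rewrite lerDl.
by rewrite ler_wpM2r ?nrm_ge0// ler_norm.
Qed.

Variable G : gfem X.

Lemma Bp_psd i : psd_on setT (Bp G i).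
Proof. by move=> u _; have := Bp_ge0 (g := G) u; rewrite lecE => /andP[]. Qed.

Lemma nwidth_ge0 m i : (0 <= nwidth G m i)%E.
Proof.
apply/ereal_infP => _ [Q _ <-].
apply: (@le_trans _ _ (ereal_inf [set (`‖Phat 0 - v‖ / seminrm (Bp G i) 0)%:E | v in Q])).
  apply/ereal_infP => _ [v _ <-].
  by rewrite lee_fin divr_ge0 ?nrm_ge0 ?seminrm_ge0.
apply: ereal_sup_ubound; exists 0 => //; split; first by case: (HB_subspace (oms G i)).
by move=> w _; rewrite /Phat !linear0 linear0l.
Qed.

(** Optimality of the spectral space for the n-width: [span_width_witness]
    supplies, against each competing space, a vector that is approximated at least
    as badly as the residual of [w]. *)
Theorem local_approximation i n (lam : 'I_n -> \bar R)
    (phi : 'I_n -> Hs X (oms G i)) w : (l G i < n)%N ->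
  first_eigenpairs lam phi -> HB (oms G i) w ->
  exists2 f, Sloc phi f & (`‖Phat w - P G i f‖%:E <=
    nwidth G (n - l G i) i * (seminrm (Bp G i) w)%:E)%E.
Proof.
move=> ln [eig lam_mono e_indep e_exhaust] Sw.
pose T : {linear Hs X (oms G i) -> H0s X (om G i)} :=
  (P G i \o res X (oms G i) (om G i))%FUN.
have hS := HB_subspace (oms G i).
have Scl := @HB_closed (oms G i).
have b_ge0 := @Bp_psd i.
have b_complete := @Bp_complete _ _ _ _ G i.
have [c b_bounded] := @Bp_bounded _ _ _ _ G i.
have [c0 hc0] := @P_bounded _ _ _ _ G i.
have cT_ge0 : 0 <= `|c0| by [].
have T_bounded u : `‖T u‖ <= `|c0| * `‖u‖.
  apply: (le_trans (hc0 _)); apply: (@le_trans _ _ (`|c0| * `‖res X (oms G i) (om G i) u‖)).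
    by rewrite ler_wpM2r ?nrm_ge0// ler_norm.
  by rewrite ler_wpM2l//; apply: res_norm; exact: om_oms.
have T_compact := @Phat_compact _ _ _ _ G i.
have K_kernel := @K_kernel _ _ _ _ G i.
have K_inj u : K G i u -> T u = 0 -> u = 0.
  move=> Ku Tu0; apply: (@Phat_inj _ _ _ _ G i) => //.
    by apply/K_kernel => v; exact: linear0l.
  by rewrite [LHS]Tu0 !linear0.
have [eK [_ KE]] := @K_dim _ _ _ _ G i.
have [a Ew'] := complement_residual hS b_ge0 (@K_sub _ _ _ _ G i) K_kernel K_inj KE
  ln eig lam_mono e_indep e_exhaust Sw.
set f := \sum_j a j *: phi j in Ew'.
exists (res X (oms G i) (om G i) f).
  by rewrite linear_sum; exists a; apply: eq_bigr => j _; rewrite linearZ_LR.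
have -> : Phat w - P G i (res X (oms G i) (om G i) f) = T (w - f).
  by rewrite linearB.
have [Tw0|TwN0] := pselect (T (w - f) = 0).
  by rewrite Tw0 nrm0 mule_ge0 ?nwidth_ge0// lee_fin seminrm_ge0.
have s_le := seminrm_residual b_ge0 (d := a) Ew'.
rewrite -/f in s_le.
have [m0 hm0] : exists m, (m = n - l G i)%N by exists (n - l G i)%N.
have lm : (l G i + m0 <= n)%N by rewrite hm0 subnKC// ltnW.
have Tw : 0 < `‖T (w - f)‖ by rewrite lt_neqAle nrm_ge0 eq_sym nrm_eq0 andbT; exact/eqP.
have width : ((`‖T (w - f)‖ / seminrm (Bp G i) (w - f))%:E <= nwidth G m0 i)%E.
  apply/ereal_infP => _ [Q [q [_ ->]] <-].
  have [u [Su uK su uq hu]] := span_width_witness hS Scl b_ge0 b_complete b_bounded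
    cT_ge0 T_bounded T_compact (@K_sub _ _ _ _ G i) K_kernel K_inj KE
    ln eig lam_mono e_indep e_exhaust q lm Ew' TwN0.
  apply: (@le_trans _ _ (ereal_inf
    [set (`‖Phat u - v‖ / seminrm (Bp G i) u)%:E | v in lin_span q])); last first.
    by apply: ereal_sup_ubound; exists u.
  apply/ereal_infP => _ [v /uq Tuv <-]; rewrite lee_fin.
  apply: (le_trans hu); rewrite ler_wpM2r ?invr_ge0 ?seminrm_ge0//.
  exact: nrm_le_orth.
have sw : 0 < seminrm (Bp G i) (w - f).
  rewrite lt_neqAle seminrm_ge0 andbT; apply/negP => /eqP z; apply: TwN0.
  have [_ uK _] := Ew'.
  by rewrite (null_eq0 b_ge0 K_kernel K_inj uK)// linear0.
rewrite -hm0; apply: (@le_trans _ _ ((`‖T (w - f)‖ / seminrm (Bp G i) (w - f))%:E *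
    (seminrm (Bp G i) w)%:E)%E); last first.
  by apply: lee_wpmul2r => //; rewrite lee_fin seminrm_ge0.
by rewrite -EFinM lee_fin mulrAC ler_pdivlMr// ler_wpM2l// nrm_ge0.
Qed.

End Local.

(** * Global error *)

Section Sums.
Variable R : realType.

Lemma sqr_sum_le k (a : 'I_k -> R) :
  (\sum_i a i) ^+ 2 <= k%:R * \sum_i a i ^+ 2.
Proof.
have : 0 <= \sum_i \sum_j (a i - a j) ^+ 2.
  by apply: sumr_ge0 => i _; apply: sumr_ge0 => j _; exact: sqr_ge0.
have -> : \sum_i \sum_j (a i - a j) ^+ 2 =
    \sum_i (k%:R * a i ^+ 2 + \sum_j a j ^+ 2 - 2 * a i * \sum_j a j).
  apply: eq_bigr => i _; rewrite mulr_sumr.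
  under eq_bigr do rewrite sqrrB addrAC -mulr_natl mulrA.
  by rewrite sumrB big_split/= sumr_const card_ord -[_ *+ k]mulr_natl.
rewrite sumrB big_split /= -mulr_sumr sumr_const card_ord -mulr_suml -mulr_sumr.
by rewrite -[_ *+ k]mulr_natl; set A := \sum_i a i; set B := \sum_i _ ^+ _; lra.
Qed.

Lemma nrm_sum (V : normedZmodType R[i]) (I : finType) (x : I -> V) :
  `‖\sum_i x i‖ <= \sum_i `‖x i‖.
Proof.
elim/big_rec2 : _ => [|i y z _ h]; first by rewrite nrm0.
by apply: (le_trans (nrmD _ _)); rewrite lerD2l.
Qed.

Lemma nrm_sum_orth (W : hilbertType R) (I : finType) (P : pred I) (x : I -> W) :
  (forall i j, P i -> P j -> i != j -> ⟪x i, x j⟫ = 0) ->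
  `‖\sum_(i | P i) x i‖ ^+ 2 = \sum_(i | P i) `‖x i‖ ^+ 2.
Proof.
move=> orth; rewrite -hdot_nrm linear_sumlz raddf_sum /=.
apply: eq_bigr => i Pi; rewrite linear_sumr (bigD1 i)//= big1 ?addr0 ?hdot_nrm//.
by move=> j /andP[Pj ji]; apply: orth => //; rewrite eq_sym.
Qed.

(** Summands of the same colour are orthogonal; across the [k] colours only
    the Cauchy-Schwarz inequality is available, whence the factor [k]. *)
Lemma nrm_sum_colored (W : hilbertType R) (I : finType) k (color : I -> 'I_k)
    (x : I -> W) :
  (forall i j, i != j -> color i = color j -> ⟪x i, x j⟫ = 0) ->
  `‖\sum_i x i‖ ^+ 2 <= k%:R * \sum_i `‖x i‖ ^+ 2.
Proof.
move=> orth; rewrite (partition_big color xpredT)//=.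
rewrite [in leRHS](partition_big color xpredT)//=.
apply: (@le_trans _ _ ((\sum_c `‖\sum_(i | color i == c) x i‖) ^+ 2)).
  rewrite ler_sqr ?nnegrE ?nrm_ge0 ?nrm_sum// sumr_ge0// => c _.
  exact: nrm_ge0.
apply: (le_trans (sqr_sum_le _)); rewrite le_eqVlt; apply/orP; left; apply/eqP.
congr (_ * _); apply: eq_bigr => c _; apply: nrm_sum_orth => i j /eqP <- /eqP ji ij.
by apply: orth.
Qed.

End Sums.

Section Global.
Variables (R : realType) (d : nat) (Om : lipschitzDomain R d).
Variables (X : framework Om) (G : gfem X).

Lemma zextB (D : subdomain Om) (u v : H0s X D) : zext (u - v) = zext u - zext v.
Proof. by rewrite /zext !linearB. Qed.

Lemma zext_nrm (D : subdomain Om) (v : H0s X D) : `‖zext v‖ = `‖v‖.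
Proof. by rewrite inc0_whole_norm ext_norm//; exact: subdom_sub. Qed.

Lemma cover_index : exists i : 'I_(M G), True.
Proof.
have [[x Omx] _ _] := ldom_domain Om.
have : (\bigcup_(i in [set: 'I_(M G)]) (om G i : set 'rV[R]_d)) x.
  by rewrite om_cover.
by move=> [i _ _]; exists i.
Qed.

Lemma dmax_ge0 n : (0 <= dmax G n)%E.
Proof.
have [i _] := cover_index; apply: (le_trans (nwidth_ge0 (n i - l G i) i)).
exact: (le_bigmax _ (fun i => nwidth G (n i - l G i) i) i).
Qed.

Lemma Phat_restr (i : 'I_(M G)) (u : HOm X) :
  Phat (restr (oms G i) u) = P G i (restr (om G i) u).
Proof.
rewrite /Phat /restr res_res//; first exact: om_oms.
exact: subdom_sub.
Qed.

Lemma restr_error_HB (F : HOm X -> R[i]) (ue : HOm X) i psi :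
  (forall v, B X ue v = F v) -> local_particular F psi ->
  HB (oms G i) (restr (oms G i) ue - psi).
Proof.
move=> ueP psiP v; rewrite linearBl /= -[Defs.form X _ psi _]/(_ : R[i]) psiP.
by rewrite /restr form_local ?ueP ?subrr//; exact: subdom_sub.
Qed.

Lemma Sglob_sub n (phi : forall i, 'I_(n i) -> Hs X (oms G i)) u v :
  Sglob phi u -> Sglob phi v -> Sglob phi (u - v).
Proof.
move=> [f [Sf ->]] [g [Sg ->]]; exists (fun i => f i - g i); split.
  by move=> i; exact: (subspaceB (subspace_span _) (Sf i) (Sg i)).
by rewrite -sumrB; apply: eq_bigr => i _; rewrite linearB zextB.
Qed.

(** Gluing the local errors: the widths of all subdomains are bounded by
    [dmax], and the coloring controls the interaction of the subdomains. *)
Theorem global_approximation (F : HOm X -> R[i]) (psi : forall i, Hs X (oms G i))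
    (n : 'I_(M G) -> nat) (lam : forall i, 'I_(n i) -> \bar R)
    (phi : forall i, 'I_(n i) -> Hs X (oms G i)) (zeta : nat) (ue : HOm X) :
  (forall i, local_particular F (psi i)) -> (forall i, (l G i < n i)%N) ->
  (forall i, first_eigenpairs (lam i) (phi i)) -> coloring_constant G zeta ->
  (forall v, B X ue v = F v) ->
  exists2 s, Sglob phi s & (`‖ue - (upart psi + s)‖%:E <= dmax G n *
    (Num.sqrt (zeta%:R *
      \sum_i seminrm (Bp G i) (restr (oms G i) ue - psi i) ^+ 2))%:E)%E.
Proof.
move=> psiP n_gt phiP [color orth] ueP.
pose w i := restr (oms G i) ue - psi i.
have local i := cid2 (local_approximation (n_gt i) (phiP i)
  (restr_error_HB ueP (psiP i))).
pose f i := s2val (local i).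
have Sf i : Sloc (phi i) (f i) by exact: (s2valP (local i)).
pose D i := Phat (w i) - P G i (f i).
have hD i : (`‖D i‖%:E <= nwidth G (n i - l G i) i * (seminrm (Bp G i) (w i))%:E)%E.
  exact: (s2valP' (local i)).
exists (\sum_i zext (P G i (f i))); first by exists f.
have -> : ue - (upart psi + \sum_i zext (P G i (f i))) = \sum_i zext (D i).
  rewrite opprD addrA {1}(P_sum G ue) -!sumrB; apply: eq_bigr => i _.
  by rewrite /D zextB -Phat_restr /w /Phat !linearB zextB.
have glue : `‖\sum_i zext (D i)‖ ^+ 2 <= zeta%:R * \sum_i `‖D i‖ ^+ 2.
  apply: (le_trans (nrm_sum_colored (color := color) _)).
    by move=> i j ij cij; exact: orth.
  by under eq_bigr do rewrite zext_nrm.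
pose s i := seminrm (Bp G i) (w i).
have s0 i : 0 <= s i by exact: seminrm_ge0.
have -> : \sum_i seminrm (Bp G i) (restr (oms G i) ue - psi i) ^+ 2 = \sum_i s i ^+ 2 by [].
have hDmax i : (`‖D i‖%:E <= dmax G n * (s i)%:E)%E.
  apply: (le_trans (hD i)); apply: lee_wpmul2r; first by rewrite lee_fin seminrm_ge0.
  exact: (le_bigmax _ (fun i => nwidth G (n i - l G i) i) i).
have zeta0 : (0 < zeta)%N.
  have [i _] := cover_index.
  exact: leq_ltn_trans (leq0n _) (ltn_ord (color i)).
have sum0 : 0 <= \sum_i s i ^+ 2 by apply: sumr_ge0 => i _; exact: sqr_ge0.
have D0 := dmax_ge0 n; case DE : (dmax G n) D0 hDmax => [r| |]// r0 hr.
  rewrite -EFinM lee_fin -ler_sqr ?nnegrE ?nrm_ge0 ?mulr_ge0 ?sqrtr_ge0//.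
  rewrite exprMn sqr_sqrtr ?mulr_ge0//; apply: (le_trans glue).
  rewrite mulrCA ler_wpM2l// mulr_sumr; apply: ler_sum => i _.
  rewrite -exprMn ler_sqr ?nnegrE ?nrm_ge0 ?mulr_ge0//.
  by have := hr i; rewrite -EFinM lee_fin.
(* With an infinite width the bound is [+oo], unless all seminorms vanish: then
   it is [+oo * 0 = 0], and the local errors vanish too. *)
have [z|zN0] := eqVneq (\sum_i s i ^+ 2) 0; last first.
  rewrite gt0_mulye ?leey// lte_fin sqrtr_gt0 mulr_gt0 ?ltr0n//.
  by rewrite lt_neqAle eq_sym zN0.
rewrite z mulr0 sqrtr0 mule0 lee_fin.
have Di i : `‖D i‖ = 0.
  have si : s i = 0.
    apply/eqP; rewrite -sqrf_eq0.
    by have /psumr_eq0P -> := z => // j _; exact: sqr_ge0.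
  apply/eqP; rewrite eq_le nrm_ge0 andbT -lee_fin.
  by apply: (le_trans (hr i)); rewrite si mule0.
move: glue; rewrite [Z in _ * Z]big1 ?mulr0; last by move=> i _; rewrite Di expr0n.
by move=> /= h; rewrite -ler_sqr ?nnegrE ?nrm_ge0// expr0n /=.
Qed.

(** Coercivity bounds the squared norm of the error [a] by [B a a], which equals
    [B a (a + v)] by Galerkin orthogonality. *)
Lemma quasi_optimality C1 Cb (a v : HOm X) : 0 < C1 -> 0 <= Cb ->
  coercive (B X) C1 -> bounded_form (B X) Cb -> B X a v = 0 ->
  `‖a‖ <= Cb / C1 * `‖a + v‖.
Proof.
move=> C1_gt0 Cb_ge0 co bd av.
have h : C1 * `‖a‖ ^+ 2 <= Cb * `‖a‖ * `‖a + v‖.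
  apply: (le_trans (co a)); apply: le_trans (bd a (a + v)).
  by rewrite linearDr /= -[Z in _ + Z]/(B X a v) av addr0.
have [->|a0] := eqVneq a 0.
  by rewrite nrm0 mulr_ge0 ?nrm_ge0// divr_ge0// ltW.
have na : 0 < `‖a‖ by rewrite lt_neqAle nrm_ge0 eq_sym nrm_eq0 andbT.
rewrite mulrAC ler_pdivlMr// mulrC -(ler_pM2r na).
by move: h; rewrite expr2 mulrA => h; rewrite [leRHS]mulrAC.
Qed.

Lemma energy_optimality (a v : HOm X) : hermitian_form (B X) ->
  (forall u, `‖u‖%:C ^+ 2 = B X u u) -> B X a v = 0 -> `‖a‖ <= `‖a + v‖.
Proof.
move=> herm energy av.
have va : B X v a = 0 by rewrite herm av conjC0.
rewrite -ler_sqr ?nnegrE ?nrm_ge0// -lecR !rmorphXn /= !energy.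
rewrite linearDl !linearDr /= -[Z in _ <= _ + Z + _]/(B X a v) av addr0.
rewrite -[Z in _ <= _ + (Z + _)]/(B X v a) va add0r lerDl.
by rewrite -[leRHS]/(B X v v) -energy -rmorphXn ler0c sqr_ge0.
Qed.

(** The restriction of the solution splits orthogonally into the residual, which
    is orthogonal to [H_0], and the particular function, which lies in [H_0]. *)
Lemma elliptic_seminrm_le (F : HOm X -> R[i]) (psi : forall i, Hs X (oms G i))
    (ue : HOm X) i : elliptic_case psi -> local_particular F (psi i) ->
  (forall v, B X ue v = F v) ->
  seminrm (Bp G i) (restr (oms G i) ue - psi i) <=
  seminrm (Bp G i) (restr (oms G i) ue).
Proof.
move=> [_ _ BpE psi0] psiP ueP; have [p pE] := psi0 i.
set w := restr (oms G i) ue - psi i.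
have wp : Bp G i w (psi i) = 0.
  by rewrite BpE pE; exact: (restr_error_HB ueP psiP).
rewrite ler_wsqrtr//.
have -> : restr (oms G i) ue = w + psi i by rewrite /w subrK.
by rewrite (qformD_orth wp) lerDl; exact: Bp_psd.
Qed.

End Global.

Theorem theorem3p20 (R : realType) (d : nat) (hd : d = 2%N \/ d = 3%N)
    (Om : lipschitzDomain R d) (X : framework Om) (G : gfem X)
    (C1 Cb : R) (C1_gt0 : 0 < C1) (Cb_ge0 : 0 <= Cb)
    (B_coercive : coercive (B X) C1) (B_bounded : bounded_form (B X) Cb)
    (F : {antilinear (HOm X)}) (F_bounded : bounded_op F)
    (psi : forall i, Hs X (oms G i))
    (psiP : forall i, local_particular F (psi i))
    (n : 'I_(M G) -> nat) (n_gt : forall i, (l G i < n i)%N)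
    (lam : forall i, 'I_(n i) -> \bar R)
    (phi : forall i, 'I_(n i) -> Hs X (oms G i))
    (phiP : forall i, first_eigenpairs (lam i) (phi i))
    (zeta : nat) (zetaP : coloring_constant G zeta)
    (ue : HOm X) (ueP : forall v, B X ue v = F v)
    (uG : HOm X) (uGP : gfem_solution F psi phi uG) :
  (elliptic_case psi ->
   forall zeta_s : nat, overlap_constant G zeta_s ->
   (`‖ue - uG‖%:E
      <= (Num.sqrt (zeta * zeta_s)%:R)%:E * dmax G n * `‖ue‖%:E)%E) /\
  (`‖ue - uG‖%:E
     <= (Cb / C1)%:E * dmax G n *
        (Num.sqrt (zeta%:R *
           \sum_i seminrm (Bp G i) (restr (oms G i) ue - psi i) ^+ 2))%:E)%E.
Proof.
have [s Ss hs] := global_approximation psiP n_gt phiP zetaP ueP.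
have [[sG SsG uGE] uG_orth] := uGP.
set uh := upart psi + s in hs.
set sum := \sum_i _ in hs *.
have sum0 : 0 <= sum by apply: sumr_ge0 => i _; exact: sqr_ge0.
have Sv : Sglob phi (uG - uh).
  rewrite uGE /uh opprD addrACA subrr add0r; exact: Sglob_sub.
have orth : B X (ue - uG) (uG - uh) = 0.
  by rewrite linearBl /= -[Z in Z - _]/(B X ue _) ueP -[Z in _ - Z]/(B X uG _) uG_orth ?subrr.
have ueE : ue - uh = (ue - uG) + (uG - uh) by rewrite addrA subrK.
split.
  move=> ell zs [_ [_ overlap] _]; have [herm energy _ _] := ell.
  have := energy_optimality herm energy orth; rewrite -ueE -lee_fin => /le_trans; apply.
  apply: (le_trans hs); rewrite muleAC -EFinM muleC.
  apply: lee_wpmul2r; first exact: dmax_ge0.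
  rewrite lee_fin -ler_sqr ?nnegrE ?mulr_ge0 ?sqrtr_ge0 ?nrm_ge0//.
  rewrite exprMn !sqr_sqrtr ?mulr_ge0// natrM -mulrA ler_wpM2l//.
  apply: le_trans (overlap ue); apply: ler_sum => i _.
  rewrite ler_sqr ?nnegrE ?seminrm_ge0//; exact: elliptic_seminrm_le ell (psiP i) ueP.
have := quasi_optimality C1_gt0 Cb_ge0 B_coercive B_bounded orth.
rewrite -ueE -lee_fin => /le_trans; apply; rewrite EFinM -muleA.
by apply: lee_wpmul2l => //; rewrite lee_fin divr_ge0// ltW.
Qed.
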